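(* Let $\mathcal{C}$ be a good site and let $\mathcal{G}$, $\mathcal{H}$ be $\mathcal{C}$-groupoids. The following are equivalent: (1) $\mathcal{G}$ and $\mathcal{H}$ are Morita equivalent; (2) there exist a $\mathcal{C}$-groupoid $\mathcal{K}$ and a pair of weak equivalences $\mathcal{H}\leftarrow\mathcal{K}\to\mathcal{G}$.
   Context: **Good sites.** A site $\mathcal{C}$ is a category with a Grothendieck topology (given by covering sieves). A morphism $f:M\to N$ is *cartesian* if the fiber product $N'\times_N M$ exists for every $N'\to N$. It is a *submersion* if it is cartesian and admits local sections: there are a covering sieve $\{s_i:U_i\to N\}$ of $N$ and morphisms $\sigma_i:U_i\to M$ with $f\circ\sigma_i=s_i$. $\mathbf{Sub}$ is the category whose objects are submersions $P\to M$ and whose morphisms are pullback squares, projecting to $\mathcal{C}$ by passing to the base. $\mathcal{C}$ is *good* if: (GS1) $\mathcal{C}$ has an initial object; (GS2) every covering sieve is generated by cartesian morphisms; (GS3) morphisms are local: for a covering sieve $\{s_i:U_i\to M\}$ and $f_i:U_i\to N$ agreeing on all $U_{ij}=U_i\times_M U_j$ there is a unique $f:M\to N$ with $f\circ s_i=f_i$; (GS4) $\mathbf{Sub}$ is a stack over $\mathcal{C}$; (GS5) if $f\circ g$ is a submersion, then $f$ is a submersion. **Groupoids and bibundles.** A $\mathcal{C}$-groupoid $\mathcal{G}\rightrightarrows M$ is a groupoid internal to $\mathcal{C}$ whose source $\mathbf{s}$ and target $\mathbf{t}$ are submersions. For $\mathcal{G}\rightrightarrows M$, $\mathcal{H}\rightrightarrows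 N$, a $(\mathcal{G},\mathcal{H})$-bibundle is an object $P$ with morphisms $\mathbf{t}:P\to M$, $\mathbf{s}:P\to N$, a left $\mathcal{G}$-action along $\mathbf{t}$ leaving $\mathbf{s}$ invariant and a right $\mathcal{H}$-action along $\mathbf{s}$ leaving $\mathbf{t}$ invariant, which commute. It is left principal if $\mathbf{s}$ is a submersion and $\mathcal{G}\times_M P\to P\times_N P$, $(g,p)\mapsto(g\cdot p,p)$, is an isomorphism; right principal symmetrically; principal if both. A *Morita equivalence* between $\mathcal{G}$ and $\mathcal{H}$ is a principal $(\mathcal{G},\mathcal{H})$-bibundle, and $\mathcal{G}$, $\mathcal{H}$ are Morita equivalent if one exists. **Weak equivalences.** Let $F:\mathcal{G}\to\mathcal{H}$ be a homomorphism of $\mathcal{C}$-groupoids covering $f:M\to N$. $F$ is *essentially surjective* if $\mathbf{t}\circ\mathrm{pr}_1:\mathcal{H}\times_{\mathbf{s},f}M\to N$ is a submersion; *fully faithful* if $M\times_{f,\mathbf{t}}\mathcal{H}\times_{\mathbf{s},f}M$ exists and $(\mathbf{t},F,\mathbf{s}):\mathcal{G}\to M\times_{f,\mathbf{t}}\mathcal{H}\times_{\mathbf{s},f}M$ is an isomorphism; a *weak equivalence* if it is both. *)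

(* Defs.v *)
From Stdlib Require Import ProofIrrelevance IndefiniteDescription.

Set Implicit Arguments.
Unset Strict Implicit.
Unset Printing Implicit Defensive.

Record category := Category {
  ob :> Type;
  hom : ob -> ob -> Type;
  idm : forall A, hom A A;
  comp : forall A B D, hom B D -> hom A B -> hom A D;
  comp_idl : forall A B (f : hom A B), comp (idm B) f = f;
  comp_idr : forall A B (f : hom A B), comp f (idm A) = f;
  comp_assoc : forall A B D E (h : hom D E) (g : hom B D) (f : hom A B),
    comp h (comp g f) = comp (comp h g) f
}.

Arguments idm {c} A.
Arguments comp {c A B D} _ _.
Notation "g ∘ f" := (comp g f) (at level 40, left associativity).

Definition is_iso (C : category) (A B : C) (f : hom A B) : Prop :=
  exists g : hom B A, g ∘ f = idm A /\ f ∘ g = idm B.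

Definition has_initial_object (C : category) : Prop :=
  exists I : C, forall A : C, exists! f : hom I A, True.

Definition is_pullback (C : category) (A B D W : C) (f : hom A D) (g : hom B D)
    (a : hom W A) (b : hom W B) : Prop :=
  f ∘ a = g ∘ b /\
  forall (X : C) (x : hom X A) (y : hom X B), f ∘ x = g ∘ y ->
    exists! u : hom X W, a ∘ u = x /\ b ∘ u = y.

(* A choice of fiber product A ×_D B. *)
Record pullback (C : category) (A B D : C) (f : hom A D) (g : hom B D) := Pullback {
  pb_ob :> ob C;
  pb1 : hom pb_ob A;
  pb2 : hom pb_ob B;
  pb_spec : is_pullback f g pb1 pb2
}.

Section PullbackPairing.
Variables (C : category) (A B D : C) (f : hom A D) (g : hom B D).
Variable W : pullback f g.

(* The morphism (x, y) : X -> A ×_D B. *)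
Definition pb_pair (X : C) (x : hom X A) (y : hom X B) (e : f ∘ x = g ∘ y) :
    hom X W :=
  proj1_sig (constructive_definite_description _ (proj2 (pb_spec W) X x y e)).

Lemma pb_pair1 (X : C) (x : hom X A) (y : hom X B) (e : f ∘ x = g ∘ y) :
  pb1 W ∘ pb_pair e = x.
Proof. unfold pb_pair; now destruct constructive_definite_description. Qed.

Lemma pb_pair2 (X : C) (x : hom X A) (y : hom X B) (e : f ∘ x = g ∘ y) :
  pb2 W ∘ pb_pair e = y.
Proof. unfold pb_pair; now destruct constructive_definite_description. Qed.
End PullbackPairing.

Arguments pb_pair {_ _ _ _ _ _} _ {_ _ _} _.

Lemma is_pullback_id (C : category) (P M : C) (p : hom P M) :
  is_pullback (idm M) p p (idm P).
Proof.
split; [ now rewrite comp_idl, comp_idr |].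
intros X x y e; exists y; split.
- split; [ now rewrite <- e, comp_idl | apply comp_idl ].
- intros u [_ <-]; apply comp_idl.
Qed.

Lemma is_pullback_paste (C : category) (P Q R L M N : C)
    (p : hom P L) (q : hom Q M) (r : hom R N) (f : hom L M) (g : hom M N)
    (f' : hom P Q) (g' : hom Q R) :
  is_pullback f q p f' -> is_pullback g r q g' ->
  is_pullback (g ∘ f) r p (g' ∘ f').
Proof.
intros [ef uf] [eg ug]; split.
- now rewrite <- comp_assoc, ef, comp_assoc, eg, comp_assoc.
- intros X x y e; rewrite <- comp_assoc in e.
  destruct (ug X (f ∘ x) y e) as [v [[v1 v2] vu]].
  destruct (uf X x v (eq_sym v1)) as [u [[u1 u2] uu]].
  exists u; split.
  + split; [ assumption | now rewrite <- comp_assoc, u2 ].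
  + intros w [w1 w2]; apply uu; split; [ assumption |].
    apply eq_sym, vu; split.
    * now rewrite comp_assoc, <- ef, <- comp_assoc, w1.
    * now rewrite comp_assoc.
Qed.

Record sieve (C : category) (M : C) := Sieve {
  in_sieve :> forall U : C, hom U M -> Prop;
  sieve_closed : forall (U V : C) (s : hom U M) (g : hom V U),
    in_sieve s -> in_sieve (s ∘ g)
}.

Definition pullback_sieve (C : category) (M N : C) (S : sieve M) (f : hom N M) :
  sieve N.
Proof.
refine {| in_sieve := fun U g => S U (f ∘ g) |}.
intros U V s g Hs; rewrite comp_assoc; exact (sieve_closed g Hs).
Defined.

Record site := Site {
  site_cat :> category;
  covers : forall M : site_cat, sieve M -> Prop;
  covers_max : forall (M : site_cat) (S : sieve M),
    (forall (U : site_cat) (s : hom U M), S U s) -> covers S;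
  covers_pullback : forall (M N : site_cat) (S : sieve M) (f : hom N M),
    covers S -> covers (pullback_sieve S f);
  covers_trans : forall (M : site_cat) (S R : sieve M), covers S ->
    (forall (U : site_cat) (s : hom U M), S U s -> covers (pullback_sieve R s)) ->
    covers R
}.

Definition cartesian (C : category) (M N : C) (f : hom M N) : Prop :=
  forall (N' : C) (g : hom N' N), inhabited (pullback g f).

Definition submersion (C : site) (M N : C) (f : hom M N) : Prop :=
  cartesian f /\
  exists S : sieve N, covers S /\
    forall (U : C) (s : hom U N), S U s -> exists sigma : hom U M, f ∘ sigma = s.

(* A functor E -> C. The objects of E are listed by their image in C, so that
   "an object of E over M" involves no equality between objects of C; the
   morphisms of E are not, so that equations between them are plain. *)
Record category_over (C : category) := CategoryOver {
  fib : C -> Type;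
  arr : forall M N : C, fib M -> fib N -> Type;
  proj : forall (M N : C) (X : fib M) (Y : fib N), arr X Y -> hom M N;
  arr_id : forall (M : C) (X : fib M), arr X X;
  arr_comp : forall (L M N : C) (X : fib L) (Y : fib M) (Z : fib N),
    arr Y Z -> arr X Y -> arr X Z;
  arr_idl : forall (M N : C) (X : fib M) (Y : fib N) (a : arr X Y),
    arr_comp (arr_id Y) a = a;
  arr_idr : forall (M N : C) (X : fib M) (Y : fib N) (a : arr X Y),
    arr_comp a (arr_id X) = a;
  arr_assoc : forall (K L M N : C) (W : fib K) (X : fib L) (Y : fib M) (Z : fib N)
    (c : arr Y Z) (b : arr X Y) (a : arr W X),
    arr_comp c (arr_comp b a) = arr_comp (arr_comp c b) a;
  proj_id : forall (M : C) (X : fib M), proj (arr_id X) = idm M;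
  proj_comp : forall (L M N : C) (X : fib L) (Y : fib M) (Z : fib N)
    (b : arr Y Z) (a : arr X Y), proj (arr_comp b a) = proj b ∘ proj a
}.

Arguments fib {_} _ _.
Arguments arr {_ _ _ _} _ _.
Arguments proj {_ _ _ _ _ _} _.
Arguments arr_id {_ _ _} _.
Arguments arr_comp {_ _ _ _ _ _ _ _} _ _.

Definition fibred_in_groupoids (C : category) (E : category_over C) : Prop :=
  (forall (M N : C) (f : hom M N) (Y : fib E N),
     exists (X : fib E M) (a : arr X Y), proj a = f) /\
  (forall (L M N : C) (Z : fib E L) (X : fib E M) (Y : fib E N)
     (a : arr X Y) (b : arr Z Y) (g : hom L M), proj a ∘ g = proj b ->
     exists! c : arr Z X, proj c = g /\ arr_comp a c = b).

(* Descent data on a sieve S of M: functors over C from S, seen as a full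
   subcategory of C/M, to E. *)
Record descent_datum (C : category) (E : category_over C) (M : C) (S : sieve M) :=
  DescentDatum {
  dd_ob : forall (U : C) (s : hom U M), S U s -> fib E U;
  dd_arr : forall (U V : C) (s : hom U M) (r : hom V M) (Ss : S U s) (Sr : S V r)
    (g : hom U V), r ∘ g = s -> arr (dd_ob Ss) (dd_ob Sr);
  dd_proj : forall (U V : C) (s : hom U M) (r : hom V M) (Ss : S U s) (Sr : S V r)
    (g : hom U V) (e : r ∘ g = s), proj (dd_arr Ss Sr e) = g;
  dd_id : forall (U : C) (s : hom U M) (Ss : S U s) (e : s ∘ idm U = s),
    dd_arr Ss Ss e = arr_id (dd_ob Ss);
  dd_comp : forall (U V W : C) (s : hom U M) (r : hom V M) (q : hom W M)
    (Ss : S U s) (Sr : S V r) (Sq : S W q) (g : hom V W) (h : hom U V)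
    (eg : q ∘ g = r) (eh : r ∘ h = s) (egh : q ∘ (g ∘ h) = s),
    arr_comp (dd_arr Sr Sq eg) (dd_arr Ss Sr eh) = dd_arr Ss Sq egh
}.

Definition effective (C : category) (E : category_over C) (M : C) (S : sieve M)
    (d : descent_datum E S) : Prop :=
  exists (X : fib E M)
    (a : forall (U : C) (s : hom U M) (Ss : S U s), arr (dd_ob d Ss) X),
    (forall (U : C) (s : hom U M) (Ss : S U s), proj (a U s Ss) = s) /\
    (forall (U V : C) (s : hom U M) (r : hom V M) (Ss : S U s) (Sr : S V r)
       (g : hom U V) (e : r ∘ g = s),
       arr_comp (a V r Sr) (dd_arr d Ss Sr e) = a U s Ss).

(* For X, Y over M, the vertical morphisms X -> Y form a sheaf. A morphism
   s^*X -> s^*Y over U is the same as a morphism s^*X -> Y over s : U -> M, so a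
   section over the sieve S is a natural family of morphisms b a : A -> Y, where
   a : A -> X runs over all the restrictions of X to members of S. *)
Definition morphisms_glue (C : category) (E : category_over C) (M : C)
    (S : sieve M) : Prop :=
  forall (X Y : fib E M)
    (b : forall (U : C) (A : fib E U) (a : arr A X), S U (proj a) -> arr A Y),
    (forall (U : C) (A : fib E U) (a : arr A X) (Sa : S U (proj a)),
       proj (b U A a Sa) = proj a) ->
    (forall (U V : C) (A : fib E U) (B : fib E V) (c : arr A B) (a : arr B X)
       (Sa : S V (proj a)) (Sac : S U (proj (arr_comp a c))),
       b U A (arr_comp a c) Sac = arr_comp (b V B a Sa) c) ->
    exists! f : arr X Y, proj f = idm M /\
      forall (U : C) (A : fib E U) (a : arr A X) (Sa : S U (proj a)),
        arr_comp f a = b U A a Sa.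

Definition is_stack (C : site) (E : category_over C) : Prop :=
  fibred_in_groupoids E /\
  forall (M : C) (S : sieve M), covers S ->
    morphisms_glue E S /\ forall d : descent_datum E S, effective d.

Section Sub.
Variable C : site.

Record sub_ob (M : C) := SubOb {
  sub_total : C;
  sub_map : hom sub_total M;
  sub_submersion : submersion sub_map
}.

Record sub_arr (M N : C) (X : sub_ob M) (Y : sub_ob N) := SubArr {
  sub_base : hom M N;
  sub_top : hom (sub_total X) (sub_total Y);
  sub_pullback : is_pullback sub_base (sub_map Y) (sub_map X) sub_top
}.

Lemma sub_arr_eq (M N : C) (X : sub_ob M) (Y : sub_ob N) (a b : sub_arr X Y) :
  sub_base a = sub_base b -> sub_top a = sub_top b -> a = b.
Proof.
destruct a as [f f' Hf], b as [g g' Hg]; simpl; intros <- <-.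
f_equal; apply proof_irrelevance.
Qed.

Definition sub_id (M : C) (X : sub_ob M) : sub_arr X X :=
  SubArr (is_pullback_id (sub_map X)).

Definition sub_comp (L M N : C) (X : sub_ob L) (Y : sub_ob M) (Z : sub_ob N)
    (b : sub_arr Y Z) (a : sub_arr X Y) : sub_arr X Z :=
  SubArr (is_pullback_paste (sub_pullback a) (sub_pullback b)).

Definition Sub : category_over C.
Proof.
refine {| fib := sub_ob; arr := sub_arr; proj := sub_base;
          arr_id := sub_id; arr_comp := sub_comp |}; try reflexivity;
  intros; apply sub_arr_eq; simpl;
  solve [ apply comp_idl | apply comp_idr | apply comp_assoc ].
Defined.
End Sub.

(* GS3: U ×_M V need not exist for arbitrary members of S, but under GS2 agreement
   on those that exist is the usual matching condition: S is generated by
   cartesian morphisms, whose fiber products with any member of S exist. *)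
Record good_site (C : site) : Prop := GoodSite {
  GS1 : has_initial_object C;
  GS2 : forall (M : C) (S : sieve M), covers S ->
    exists T : forall U : C, hom U M -> Prop,
      (forall (U : C) (g : hom U M), T U g -> cartesian g) /\
      (forall (V : C) (s : hom V M), S V s <->
         exists (U : C) (g : hom U M) (h : hom V U), T U g /\ s = g ∘ h);
  GS3 : forall (M N : C) (S : sieve M), covers S ->
    forall f : (forall (U : C) (s : hom U M), S U s -> hom U N),
      (forall (U V : C) (s : hom U M) (r : hom V M) (Ss : S U s) (Sr : S V r)
         (UV : pullback s r), f U s Ss ∘ pb1 UV = f V r Sr ∘ pb2 UV) ->
      exists! g : hom M N,
        forall (U : C) (s : hom U M) (Ss : S U s), g ∘ s = f U s Ss;
  GS4 : is_stack (Sub C);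
  GS5 : forall (L M N : C) (f : hom M N) (g : hom L M),
    submersion (f ∘ g) -> submersion f
}.

(* The axioms are stated on generalized elements g : X -> gr_arr; by the Yoneda
   lemma these are the usual commutative diagrams. The product gh is defined
   when s(g) = t(h). *)
Record groupoid (C : site) := Groupoid {
  gr_ob : C;
  gr_arr : C;
  src : hom gr_arr gr_ob;
  tgt : hom gr_arr gr_ob;
  src_submersion : submersion src;
  tgt_submersion : submersion tgt;
  gr_pairs : pullback src tgt;
  mul : hom gr_pairs gr_arr;
  unit_ : hom gr_ob gr_arr;
  inv : hom gr_arr gr_arr;
  src_mul : src ∘ mul = src ∘ pb2 gr_pairs;
  tgt_mul : tgt ∘ mul = tgt ∘ pb1 gr_pairs;
  src_unit : src ∘ unit_ = idm gr_ob;
  tgt_unit : tgt ∘ unit_ = idm gr_ob;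
  src_inv : src ∘ inv = tgt;
  tgt_inv : tgt ∘ inv = src;
  mul_assoc : forall (X : C) (g h k : hom X gr_arr)
    (e_gh : src ∘ g = tgt ∘ h) (e_hk : src ∘ h = tgt ∘ k)
    (e1 : src ∘ (mul ∘ pb_pair gr_pairs e_gh) = tgt ∘ k)
    (e2 : src ∘ g = tgt ∘ (mul ∘ pb_pair gr_pairs e_hk)),
    mul ∘ pb_pair gr_pairs e1 = mul ∘ pb_pair gr_pairs e2;
  mul_unitl : forall (X : C) (g : hom X gr_arr)
    (e : src ∘ (unit_ ∘ (tgt ∘ g)) = tgt ∘ g), mul ∘ pb_pair gr_pairs e = g;
  mul_unitr : forall (X : C) (g : hom X gr_arr)
    (e : src ∘ g = tgt ∘ (unit_ ∘ (src ∘ g))), mul ∘ pb_pair gr_pairs e = g;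
  mul_invl : forall (X : C) (g : hom X gr_arr) (e : src ∘ (inv ∘ g) = tgt ∘ g),
    mul ∘ pb_pair gr_pairs e = unit_ ∘ (src ∘ g);
  mul_invr : forall (X : C) (g : hom X gr_arr) (e : src ∘ g = tgt ∘ (inv ∘ g)),
    mul ∘ pb_pair gr_pairs e = unit_ ∘ (tgt ∘ g)
}.

Arguments src {_} _.
Arguments tgt {_} _.
Arguments gr_pairs {_} _.
Arguments mul {_} _.
Arguments unit_ {_} _.
Arguments inv {_} _.

(* lmom and rmom are the maps t : P -> M and s : P -> N. *)
Record bibundle (C : site) (G H : groupoid C) := Bibundle {
  bb_ob : C;
  lmom : hom bb_ob (gr_ob G);
  rmom : hom bb_ob (gr_ob H);
  lpairs : pullback (src G) lmom;
  lact : hom lpairs bb_ob;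
  rpairs : pullback rmom (tgt H);
  ract : hom rpairs bb_ob;
  lmom_lact : lmom ∘ lact = tgt G ∘ pb1 lpairs;
  rmom_lact : rmom ∘ lact = rmom ∘ pb2 lpairs;
  lact_unit : forall (X : C) (p : hom X bb_ob)
    (e : src G ∘ (unit_ G ∘ (lmom ∘ p)) = lmom ∘ p), lact ∘ pb_pair lpairs e = p;
  lact_mul : forall (X : C) (g h : hom X (gr_arr G)) (p : hom X bb_ob)
    (e_gh : src G ∘ g = tgt G ∘ h) (e_hp : src G ∘ h = lmom ∘ p)
    (e1 : src G ∘ (mul G ∘ pb_pair (gr_pairs G) e_gh) = lmom ∘ p)
    (e2 : src G ∘ g = lmom ∘ (lact ∘ pb_pair lpairs e_hp)),
    lact ∘ pb_pair lpairs e1 = lact ∘ pb_pair lpairs e2;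
  rmom_ract : rmom ∘ ract = src H ∘ pb2 rpairs;
  lmom_ract : lmom ∘ ract = lmom ∘ pb1 rpairs;
  ract_unit : forall (X : C) (p : hom X bb_ob)
    (e : rmom ∘ p = tgt H ∘ (unit_ H ∘ (rmom ∘ p))), ract ∘ pb_pair rpairs e = p;
  ract_mul : forall (X : C) (p : hom X bb_ob) (h k : hom X (gr_arr H))
    (e_ph : rmom ∘ p = tgt H ∘ h) (e_hk : src H ∘ h = tgt H ∘ k)
    (e1 : rmom ∘ (ract ∘ pb_pair rpairs e_ph) = tgt H ∘ k)
    (e2 : rmom ∘ p = tgt H ∘ (mul H ∘ pb_pair (gr_pairs H) e_hk)),
    ract ∘ pb_pair rpairs e1 = ract ∘ pb_pair rpairs e2;
  act_commute : forall (X : C) (g : hom X (gr_arr G)) (p : hom X bb_ob)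
    (h : hom X (gr_arr H))
    (e_gp : src G ∘ g = lmom ∘ p) (e_ph : rmom ∘ p = tgt H ∘ h)
    (e1 : rmom ∘ (lact ∘ pb_pair lpairs e_gp) = tgt H ∘ h)
    (e2 : src G ∘ g = lmom ∘ (ract ∘ pb_pair rpairs e_ph)),
    ract ∘ pb_pair rpairs e1 = lact ∘ pb_pair lpairs e2
}.

Arguments lmom {_ _ _} _.
Arguments rmom {_ _ _} _.
Arguments lpairs {_ _ _} _.
Arguments rpairs {_ _ _} _.
Arguments lact {_ _ _} _.
Arguments ract {_ _ _} _.

Definition left_principal (C : site) (G H : groupoid C) (P : bibundle G H) : Prop :=
  submersion (rmom P) /\
  exists PP : pullback (rmom P) (rmom P), is_iso (pb_pair PP (rmom_lact P)).

Definition right_principal (C : site) (G H : groupoid C) (P : bibundle G H) : Prop :=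
  submersion (lmom P) /\
  exists PP : pullback (lmom P) (lmom P),
    is_iso (pb_pair PP (eq_sym (lmom_ract P))).

Definition principal (C : site) (G H : groupoid C) (P : bibundle G H) : Prop :=
  left_principal P /\ right_principal P.

Definition morita_equivalent (C : site) (G H : groupoid C) : Prop :=
  exists P : bibundle G H, principal P.

Record groupoid_hom (C : site) (G H : groupoid C) := GroupoidHom {
  hom_ob : hom (gr_ob G) (gr_ob H);
  hom_arr : hom (gr_arr G) (gr_arr H);
  hom_src : src H ∘ hom_arr = hom_ob ∘ src G;
  hom_tgt : hom_ob ∘ tgt G = tgt H ∘ hom_arr;
  hom_unit : hom_arr ∘ unit_ G = unit_ H ∘ hom_ob;
  hom_mul : forall (X : C) (g h : hom X (gr_arr G))
    (e : src G ∘ g = tgt G ∘ h)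
    (e' : src H ∘ (hom_arr ∘ g) = tgt H ∘ (hom_arr ∘ h)),
    hom_arr ∘ (mul G ∘ pb_pair (gr_pairs G) e) =
    mul H ∘ pb_pair (gr_pairs H) e'
}.

Arguments hom_ob {_ _ _} _.
Arguments hom_arr {_ _ _} _.

Definition essentially_surjective (C : site) (G H : groupoid C)
    (F : groupoid_hom G H) : Prop :=
  exists E : pullback (src H) (hom_ob F), submersion (tgt H ∘ pb1 E).

Lemma hom_triple_eq (C : site) (G H : groupoid C) (F : groupoid_hom G H)
    (A : pullback (hom_ob F) (tgt H)) :
  (src H ∘ pb2 A) ∘ pb_pair A (hom_tgt F) = hom_ob F ∘ src G.
Proof. now rewrite <- comp_assoc, pb_pair2, hom_src. Qed.

(* The triple fiber product is (M ×_{f,t} H) ×_{s,f} M, whose inner factor always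
   exists because t is a submersion. *)
Definition fully_faithful (C : site) (G H : groupoid C)
    (F : groupoid_hom G H) : Prop :=
  exists (A : pullback (hom_ob F) (tgt H)) (B : pullback (src H ∘ pb2 A) (hom_ob F)),
    is_iso (pb_pair B (hom_triple_eq A)).

Definition weak_equivalence (C : site) (G H : groupoid C)
    (F : groupoid_hom G H) : Prop :=
  essentially_surjective F /\ fully_faithful F.

(* Main.v *)
From Stdlib Require Import ssreflect ProofIrrelevance ClassicalDescription
  IndefiniteDescription.
Require Import Defs.

Set Implicit Arguments.
Unset Strict Implicit.
Unset Printing Implicit Defensive.

(** The proof works with generalized elements and replaces a principal bibundle
    by an equivalent, more symmetric object: a bitorsor, that is, an object [P]
    with submersions to the bases of [G] and [H] and two commuting left actions,
    each of which is simply transitive on the fibers of the anchor of the other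
    (lemma [morita_equivalent_bitorsor]). Bitorsors can be reversed by
    exchanging the two actions, so most arguments are needed on one side only.

    From a bitorsor [P] to weak equivalences: the action groupoid of [G] and [H]
    acting together on [P] has arrows [(g, h, p)] from [p] to [g h p]. It projects
    to [G] and to [H]. Each projection covers a submersion, which gives essential
    surjectivity, and each is fully faithful because the action of the other
    groupoid is simply transitive ([weak_equivalences_of_bitorsor]).

    From weak equivalences to a bitorsor: a weak equivalence [F] from [K] to [G]
    makes the object of pairs [(g, x)] with [src g = F x] a bitorsor between [G]
    and [K]; essential surjectivity says that one anchor is a submersion, and
    full faithfulness that [K] acts simply transitively on its fibers
    ([bitorsor_of_weak_equivalence]). Applied to both legs, this gives a
    bitorsor [P] between [G] and [K] and a bitorsor [Q] between [K] and [H], and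
    it remains to compose them, that is, to form the quotient [R] of [P ×_K Q] by
    the diagonal action of [K].

    This quotient is where the stack axiom enters ([tensor_exists]). Over a
    morphism [s] to the base of [G] that lifts to [P], the choice of a lift [p]
    should identify the pullback of [R] with that of [Q] along the image of [p]
    in the base of [K]. These pullbacks are submersions; two lifts of [s] differ
    by a unique element of [K], whose action on [Q] compares them, and
    uniqueness makes the comparisons a descent datum. Its effectiveness yields
    [R]. The anchors and actions on [R], and the elements witnessing
    transitivity, are then glued from classes of pairs ([bitorsor_of_tensor]);
    the anchors are submersions by axiom GS5, since their composites with
    the projection from [P ×_K Q] are. *)

(** * Fiber products and submersions *)

Section FiberProducts.
Variables (C : category) (A B D : C) (f : hom A D) (g : hom B D).

Lemma pb_comm (W : pullback f g) : f ∘ pb1 W = g ∘ pb2 W.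
Proof. exact: (proj1 (pb_spec W)). Qed.

Lemma pb_ext (W : pullback f g) (X : C) (u v : hom X W) :
  pb1 W ∘ u = pb1 W ∘ v -> pb2 W ∘ u = pb2 W ∘ v -> u = v.
Proof.
move=> e1 e2.
have e : f ∘ (pb1 W ∘ v) = g ∘ (pb2 W ∘ v) by rewrite !comp_assoc pb_comm.
have [w [_ wu]] := proj2 (pb_spec W) X _ _ e.
by rewrite -(wu u (conj e1 e2)) -(wu v (conj eq_refl eq_refl)).
Qed.

Lemma pullback_of_elements (W : C) (a : hom W A) (b : hom W B) :
  f ∘ a = g ∘ b ->
  (forall (X : C) (x : hom X A) (y : hom X B), f ∘ x = g ∘ y ->
     exists u : hom X W, a ∘ u = x /\ b ∘ u = y) ->
  (forall (X : C) (u v : hom X W), a ∘ u = a ∘ v -> b ∘ u = b ∘ v -> u = v) ->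
  is_pullback f g a b.
Proof.
move=> e ex un; split=> // X x y exy.
have [u [u1 u2]] := ex X x y exy.
exists u; split=> // v [v1 v2]; apply: un; congruence.
Qed.

Lemma pb_pair_comp (W : pullback f g) (X Y : C) (x : hom X A) (y : hom X B)
    (u : hom Y X) (e : f ∘ x = g ∘ y) (e' : f ∘ (x ∘ u) = g ∘ (y ∘ u)) :
  pb_pair W e ∘ u = pb_pair W e'.
Proof. by apply: (@pb_ext W); rewrite comp_assoc !(pb_pair1, pb_pair2). Qed.

Lemma pb_pair_eta (W : pullback f g) (X : C) (u : hom X W)
    (e : f ∘ (pb1 W ∘ u) = g ∘ (pb2 W ∘ u)) : pb_pair W e = u.
Proof. by apply: (@pb_ext W); rewrite ?pb_pair1 ?pb_pair2. Qed.

Lemma pb_pair_generic (W : pullback f g) : pb_pair W (pb_comm W) = idm W.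
Proof. by apply: (@pb_ext W); rewrite ?pb_pair1 ?pb_pair2 comp_idr. Qed.

End FiberProducts.

Definition pullback_sym (C : category) (A B D : C) (f : hom A D) (g : hom B D)
    (W : pullback f g) : pullback g f.
Proof.
apply: (@Pullback _ _ _ _ _ _ W (pb2 W) (pb1 W)).
apply: pullback_of_elements.
- by rewrite pb_comm.
- move=> X x y e; exists (pb_pair W (eq_sym e)).
  by rewrite pb_pair1 pb_pair2.
- by move=> X u v e1 e2; apply: (@pb_ext _ _ _ _ _ _ W).
Defined.

(** Choices of fiber products enter the descent datum below as data, whereas
    cartesian morphisms only provide their existence. *)
Definition pick_pullback (C : category) (A B D : C) (f : hom A D) (g : hom B D)
    (ex : inhabited (pullback f g)) : pullback f g :=
  proj1_sig (constructive_indefinite_description (fun _ => True)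
    (match ex with inhabits W => ex_intro _ W I end)).

Lemma comp_eq (C : category) (A B D E : C) (f : hom B E) (g : hom D E)
    (x : hom A B) (y : hom A D) (X : C) (u : hom X A) :
  f ∘ x = g ∘ y -> f ∘ (x ∘ u) = g ∘ (y ∘ u).
Proof. by move=> e; rewrite !comp_assoc e. Qed.

(** The Yoneda lemma: this turns principality and full faithfulness, which are
    defined by isomorphisms, into unique solvability of equations. *)
Lemma is_iso_elements (C : category) (A B : C) (f : hom A B) :
  is_iso f <->
  forall (X : C) (y : hom X B), exists! x : hom X A, f ∘ x = y.
Proof.
split=> [[g [gf fg]] X y | H].
- exists (g ∘ y); split=> [|x <-]; first by rewrite comp_assoc fg comp_idl.
  by rewrite comp_assoc gf comp_idl.
- have [g [fg _]] := H B (idm B).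
  exists g; split=> //.
  have [x [_ xu]] := H A f.
  rewrite -(xu (g ∘ f)) ?comp_assoc ?fg ?comp_idl //.
  by apply: xu; rewrite comp_idr.
Qed.

Section Submersions.
Variable C : site.

Lemma cartesian_comp (L M N : C) (f : hom M N) (g : hom L M) :
  cartesian f -> cartesian g -> cartesian (f ∘ g).
Proof.
move=> cf cg N' h.
have [V] := cf N' h.
have [W] := cg V (pb2 V).
split; apply: (@Pullback _ _ _ _ _ _ W (pb1 V ∘ pb1 W) (pb2 W)).
apply: pullback_of_elements.
- by rewrite comp_assoc pb_comm -comp_assoc pb_comm comp_assoc.
- move=> X x y e.
  have e1 : h ∘ x = f ∘ (g ∘ y) by rewrite e comp_assoc.
  have e2 : pb2 V ∘ pb_pair V e1 = g ∘ y by rewrite pb_pair2.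
  exists (pb_pair W e2).
  by rewrite -comp_assoc !pb_pair1 pb_pair2.
- move=> X u v e1 e2; apply: (@pb_ext _ _ _ _ _ _ W) => //.
  apply: (@pb_ext _ _ _ _ _ _ V); first by rewrite !comp_assoc.
  by rewrite !comp_assoc pb_comm -!comp_assoc e2.
Qed.

Lemma cartesian_base_change (M N N' W : C) (f : hom M N) (h : hom N' N)
    (a : hom W N') (b : hom W M) :
  is_pullback h f a b -> cartesian f -> cartesian a.
Proof.
move=> HW cf Z k.
have [V] := cf Z (h ∘ k).
pose P := Pullback HW.
have e : h ∘ (k ∘ pb1 V) = f ∘ pb2 V by rewrite comp_assoc pb_comm.
have e1 := pb_pair1 P e; have e2 := pb_pair2 P e; rewrite /= in e1 e2.
split; apply: (@Pullback _ _ _ _ _ _ V (pb1 V) (pb_pair P e)).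
apply: pullback_of_elements; first by rewrite e1.
- move=> X x y exy.
  have e3 : (h ∘ k) ∘ x = f ∘ (b ∘ y).
    by rewrite -comp_assoc exy !comp_assoc (proj1 HW).
  exists (pb_pair V e3); rewrite pb_pair1; split=> //.
  apply: (@pb_ext _ _ _ _ _ _ P) => /=; rewrite comp_assoc ?e1 ?e2.
  + by rewrite -comp_assoc pb_pair1.
  + by rewrite pb_pair2.
- move=> X u v eu ev; apply: (@pb_ext _ _ _ _ _ _ V) => //.
  by rewrite -e2 -!comp_assoc ev.
Qed.

Lemma submersion_base_change (M N N' W : C) (f : hom M N) (h : hom N' N)
    (a : hom W N') (b : hom W M) :
  is_pullback h f a b -> submersion f -> submersion a.
Proof.
move=> HW [cf [S [cS HS]]]; split; first exact: cartesian_base_change HW cf.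
exists (pullback_sieve S h); split; first exact: covers_pullback.
move=> U s /HS [sigma e].
have [u [[u1 _] _]] := proj2 HW U s sigma (eq_sym e).
by exists u.
Qed.

Lemma submersion_pb1 (M N N' : C) (f : hom M N) (h : hom N' N)
    (W : pullback h f) : submersion f -> submersion (pb1 W).
Proof. exact: submersion_base_change (pb_spec W). Qed.

Lemma submersion_pb2 (M N N' : C) (f : hom M N) (h : hom N' N)
    (W : pullback f h) : submersion f -> submersion (pb2 W).
Proof. exact: submersion_base_change (pb_spec (pullback_sym W)). Qed.

End Submersions.

(** * Local arguments *)

Definition locally (C : site) (X : C) (P : forall U : C, hom U X -> Prop) : Prop :=
  exists S : sieve X, covers S /\ forall (U : C) (v : hom U X), S U v -> P U v.

Section Locality.
Variable C : site.

Lemma locally_mono (X : C) (P Q : forall U : C, hom U X -> Prop) :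
  (forall (U : C) (v : hom U X), P U v -> Q U v) -> locally P -> locally Q.
Proof. move=> PQ [S [cS SP]]; exists S; split=> // U v /SP; exact: PQ. Qed.

Lemma covers_mono (X : C) (S T : sieve X) :
  (forall (U : C) (v : hom U X), S U v -> T U v) -> covers S -> covers T.
Proof.
move=> ST cS; apply: (covers_trans cS) => U v Sv.
by apply: covers_max => V w; apply: ST; apply: sieve_closed.
Qed.

Lemma locally_and (X : C) (P Q : forall U : C, hom U X -> Prop) :
  locally P -> locally Q -> locally (fun U v => P U v /\ Q U v).
Proof.
move=> [S [cS SP]] [T [cT TQ]].
unshelve eexists.
  refine (@Sieve _ _ (fun U v => S U v /\ T U v) _).
  by move=> U V s g [] ??; split; apply: sieve_closed.
split; last by move=> U v [/SP ? /TQ ?].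
apply: (covers_trans cS) => U s Ss.
apply: covers_mono (covers_pullback s cT) => V v /= Tv; split=> //.
exact: sieve_closed.
Qed.

Definition lifting_sieve (M N : C) (f : hom M N) : sieve N.
Proof.
refine (@Sieve _ N (fun U s => exists sigma : hom U M, f ∘ sigma = s) _).
by move=> U V s g [sigma <-]; exists (sigma ∘ g); rewrite comp_assoc.
Defined.

Lemma lifting_sieve_covers (M N : C) (f : hom M N) :
  submersion f -> covers (lifting_sieve f).
Proof. by move=> [_ [S [cS HS]]]; apply: covers_mono cS. Qed.

Lemma submersion_locally (X M N : C) (f : hom M N) (y : hom X N) :
  submersion f ->
  locally (fun U (v : hom U X) => exists m : hom U M, f ∘ m = y ∘ v).
Proof.
move=> sf; exists (pullback_sieve (lifting_sieve f) y); split=> //.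
exact: covers_pullback (lifting_sieve_covers sf).
Qed.

Lemma submersion_comp (L M N : C) (f : hom M N) (g : hom L M) :
  submersion f -> submersion g -> submersion (f ∘ g).
Proof.
move=> sf sg; split; first exact: cartesian_comp (proj1 sf) (proj1 sg).
exists (lifting_sieve (f ∘ g)); split=> //.
have [_ [S [cS HS]]] := sf.
apply: (covers_trans cS) => U s /HS [m em].
have [T [cT HT]] := submersion_locally m sg.
apply: covers_mono cT => V v /HT [l el] /=.
by exists l; rewrite -comp_assoc el comp_assoc em.
Qed.

Hypothesis hC : good_site C.

(** Uniqueness in the gluing of morphisms: [x] and [y] both glue the
    restrictions of [y] to the cover. *)
Lemma locally_eq (X Z : C) (x y : hom X Z) :
  locally (fun U (v : hom U X) => x ∘ v = y ∘ v) -> x = y.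
Proof.
move=> [S [cS HS]].
have [|g [_ gu]] := GS3 hC cS (f := fun U s _ => y ∘ s).
  by move=> U V s r _ _ UV; rewrite -!comp_assoc pb_comm.
by rewrite -(gu x) ?(gu y).
Qed.

(** The form in which the gluing of morphisms is used: to define a morphism
    it is enough to specify its values by a functional relation that is
    inhabited locally. Compatibility on overlaps is then automatic. *)
Lemma locally_glue (X Z : C) (Phi : forall U : C, hom U X -> hom U Z -> Prop) :
  (forall (U V : C) (v : hom U X) (z : hom U Z) (u : hom V U),
     Phi U v z -> Phi V (v ∘ u) (z ∘ u)) ->
  (forall (U : C) (v : hom U X) (z z' : hom U Z), Phi U v z -> Phi U v z' -> z = z') ->
  locally (fun U v => exists z, Phi U v z) ->
  exists g : hom X Z, forall (U : C) (v : hom U X) (z : hom U Z), Phi U v z -> g ∘ v = z.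
Proof.
move=> nat fn [S [cS HS]].
pose f U s Ss := proj1_sig (constructive_indefinite_description _ (HS U s Ss)).
have fP U s Ss : Phi U s (f U s Ss) by rewrite /f; case: constructive_indefinite_description.
have [|g [gf _]] := GS3 hC cS (f := f).
  move=> U V s r Ss Sr UV; apply: (fn _ (s ∘ pb1 UV)); first exact: nat.
  by rewrite pb_comm; apply: nat.
exists g => U v z Pz; apply: locally_eq.
exists (pullback_sieve S v); split; first exact: covers_pullback.
move=> V w Sw; rewrite -comp_assoc (gf _ _ Sw).
by apply: (fn _ (v ∘ w)); last exact: nat.
Qed.

End Locality.

(** * Groupoids and their actions on generalized elements *)

(** The values of a partially defined operation [m] on generalized elements,
    extended by [z] where it is not defined. Totality frees equations between
    iterated products from the proofs that the products are defined. *)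
Definition papp (C : category) (A B D Z : C) (f : hom A D) (g : hom B D)
    (W : pullback f g) (m : hom W Z) (X : C) (x : hom X A) (y : hom X B)
    (z : hom X Z) : hom X Z :=
  match excluded_middle_informative (f ∘ x = g ∘ y) with
  | left e => m ∘ pb_pair W e
  | right _ => z
  end.

Section PartialOperations.
Variables (C : category) (A B D Z : C) (f : hom A D) (g : hom B D).
Variable W : pullback f g.

Lemma papp_eq (m : hom W Z) (X : C) (x : hom X A) (y : hom X B) (z : hom X Z)
    (e : f ∘ x = g ∘ y) : papp m x y z = m ∘ pb_pair W e.
Proof.
rewrite /papp; case: excluded_middle_informative => // e'.
by rewrite (proof_irrelevance _ e e').
Qed.

Lemma papp_comp (m : hom W Z) (X Y : C) (x : hom X A) (y : hom X B)
    (z : hom X Z) (u : hom Y X) (z' : hom Y Z) :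
  f ∘ x = g ∘ y -> papp m x y z ∘ u = papp m (x ∘ u) (y ∘ u) z'.
Proof.
move=> e; have e' : f ∘ (x ∘ u) = g ∘ (y ∘ u) by exact: comp_eq.
by rewrite (papp_eq _ _ e) (papp_eq _ _ e') -comp_assoc (pb_pair_comp W e e').
Qed.

(** Yoneda again, now to recover structure morphisms, defined by their values
    at generic pairs, from operations on generalized elements. *)
Lemma natural_op_eq (op : forall X : C, hom X A -> hom X B -> hom X Z) :
  (forall (X Y : C) (x : hom X A) (y : hom X B) (u : hom Y X),
     f ∘ x = g ∘ y -> op X x y ∘ u = op Y (x ∘ u) (y ∘ u)) ->
  forall (X : C) (x : hom X A) (y : hom X B) (e : f ∘ x = g ∘ y),
    op W (pb1 W) (pb2 W) ∘ pb_pair W e = op X x y.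
Proof. by move=> nat X x y e; rewrite nat ?pb_comm // pb_pair1 pb_pair2. Qed.

End PartialOperations.

Definition gm (C : site) (G : groupoid C) (X : C) (g h : hom X (gr_arr G)) :
    hom X (gr_arr G) :=
  papp (mul G) g h g.

Notation "g ⋅ h" := (gm g h) (at level 38, left associativity).

Section GroupoidCalculus.
Variables (C : site) (G : groupoid C).
Implicit Types (X Y : C).

Lemma gm_eq X (g h : hom X (gr_arr G)) (e : src G ∘ g = tgt G ∘ h) :
  mul G ∘ pb_pair (gr_pairs G) e = g ⋅ h.
Proof. by rewrite /gm (papp_eq _ _ e). Qed.

Lemma gm_comp X Y (g h : hom X (gr_arr G)) (u : hom Y X) :
  src G ∘ g = tgt G ∘ h -> (g ⋅ h) ∘ u = (g ∘ u) ⋅ (h ∘ u).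
Proof. exact: papp_comp. Qed.

Lemma src_gm X (g h : hom X (gr_arr G)) :
  src G ∘ g = tgt G ∘ h -> src G ∘ (g ⋅ h) = src G ∘ h.
Proof. by move=> e; rewrite -(gm_eq e) comp_assoc src_mul -comp_assoc pb_pair2. Qed.

Lemma tgt_gm X (g h : hom X (gr_arr G)) :
  src G ∘ g = tgt G ∘ h -> tgt G ∘ (g ⋅ h) = tgt G ∘ g.
Proof. by move=> e; rewrite -(gm_eq e) comp_assoc tgt_mul -comp_assoc pb_pair1. Qed.

Lemma src_unit_el X (x : hom X (gr_ob G)) : src G ∘ (unit_ G ∘ x) = x.
Proof. by rewrite comp_assoc src_unit comp_idl. Qed.

Lemma tgt_unit_el X (x : hom X (gr_ob G)) : tgt G ∘ (unit_ G ∘ x) = x.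
Proof. by rewrite comp_assoc tgt_unit comp_idl. Qed.

Lemma src_inv_el X (g : hom X (gr_arr G)) : src G ∘ (inv G ∘ g) = tgt G ∘ g.
Proof. by rewrite comp_assoc src_inv. Qed.

Lemma tgt_inv_el X (g : hom X (gr_arr G)) : tgt G ∘ (inv G ∘ g) = src G ∘ g.
Proof. by rewrite comp_assoc tgt_inv. Qed.

Lemma gmA X (g h k : hom X (gr_arr G)) :
  src G ∘ g = tgt G ∘ h -> src G ∘ h = tgt G ∘ k -> (g ⋅ h) ⋅ k = g ⋅ (h ⋅ k).
Proof.
move=> e1 e2.
have e3 : src G ∘ (g ⋅ h) = tgt G ∘ k by rewrite src_gm.
have e4 : src G ∘ g = tgt G ∘ (h ⋅ k) by rewrite tgt_gm.
rewrite -(gm_eq e3) -(gm_eq e4).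
by move: e3 e4; rewrite -(gm_eq e1) -(gm_eq e2) => e3 e4; apply: mul_assoc.
Qed.

Lemma gm1g X (g : hom X (gr_arr G)) : (unit_ G ∘ (tgt G ∘ g)) ⋅ g = g.
Proof. by rewrite -gm_eq ?src_unit_el // => e; apply: mul_unitl. Qed.

Lemma gmg1 X (g : hom X (gr_arr G)) : g ⋅ (unit_ G ∘ (src G ∘ g)) = g.
Proof. by rewrite -gm_eq ?tgt_unit_el // => e; apply: mul_unitr. Qed.

Lemma gmVg X (g : hom X (gr_arr G)) : (inv G ∘ g) ⋅ g = unit_ G ∘ (src G ∘ g).
Proof. by rewrite -gm_eq ?src_inv_el // => e; apply: mul_invl. Qed.

Lemma gmgV X (g : hom X (gr_arr G)) : g ⋅ (inv G ∘ g) = unit_ G ∘ (tgt G ∘ g).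
Proof. by rewrite -gm_eq ?tgt_inv_el // => e; apply: mul_invr. Qed.

Lemma gmKV X (g h : hom X (gr_arr G)) :
  src G ∘ g = tgt G ∘ h -> (inv G ∘ g) ⋅ (g ⋅ h) = h.
Proof. by move=> e; rewrite -gmA ?src_inv_el // gmVg e gm1g. Qed.

Lemma gmVK X (g h : hom X (gr_arr G)) :
  tgt G ∘ g = tgt G ∘ h -> g ⋅ ((inv G ∘ g) ⋅ h) = h.
Proof. by move=> e; rewrite -gmA ?src_inv_el ?tgt_inv_el // gmgV e gm1g. Qed.

Lemma gmK X (g h : hom X (gr_arr G)) :
  src G ∘ g = tgt G ∘ h -> (g ⋅ h) ⋅ (inv G ∘ h) = g.
Proof. by move=> e; rewrite gmA ?tgt_inv_el // gmgV -e gmg1. Qed.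

Lemma gmVKr X (g h : hom X (gr_arr G)) :
  src G ∘ g = src G ∘ h -> (g ⋅ (inv G ∘ h)) ⋅ h = g.
Proof. by move=> e; rewrite gmA ?tgt_inv_el ?src_inv_el // gmVg -e gmg1. Qed.

Lemma gm_cancelr X (g g' h : hom X (gr_arr G)) :
  src G ∘ g = tgt G ∘ h -> src G ∘ g' = tgt G ∘ h -> g ⋅ h = g' ⋅ h -> g = g'.
Proof. by move=> e e' E; rewrite -(gmK e) E gmK. Qed.

Lemma inv_inv X (g : hom X (gr_arr G)) : inv G ∘ (inv G ∘ g) = g.
Proof.
apply: (@gm_cancelr _ _ _ (inv G ∘ g)); rewrite ?src_inv_el ?tgt_inv_el //.
by rewrite gmVg gmgV src_inv_el.
Qed.

Lemma inv_gm X (g h : hom X (gr_arr G)) :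
  src G ∘ g = tgt G ∘ h -> inv G ∘ (g ⋅ h) = (inv G ∘ h) ⋅ (inv G ∘ g).
Proof.
move=> e.
have e' : src G ∘ (inv G ∘ h) = tgt G ∘ (inv G ∘ g).
  by rewrite src_inv_el tgt_inv_el.
apply: (@gm_cancelr _ _ _ (g ⋅ h)); rewrite ?src_gm ?src_inv_el ?tgt_gm ?tgt_inv_el //.
rewrite gmVg gmA ?src_inv_el ?tgt_inv_el ?tgt_gm //.
by rewrite gmKV // gmVg src_gm.
Qed.

Lemma inv_unit X (x : hom X (gr_ob G)) : inv G ∘ (unit_ G ∘ x) = unit_ G ∘ x.
Proof.
have e := gm1g (unit_ G ∘ x); rewrite tgt_unit_el in e.
apply: (@gm_cancelr _ _ _ (unit_ G ∘ x)).
- by rewrite src_inv_el.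
- by rewrite src_unit_el tgt_unit_el.
- by rewrite gmVg src_unit_el e.
Qed.

End GroupoidCalculus.

Record action (C : site) (G : groupoid C) (P : C) (a : hom P (gr_ob G)) := Action {
  act : forall X : C, hom X (gr_arr G) -> hom X P -> hom X P;
  act_comp : forall (X Y : C) (g : hom X (gr_arr G)) (p : hom X P) (u : hom Y X),
    src G ∘ g = a ∘ p -> act g p ∘ u = act (g ∘ u) (p ∘ u);
  anchor_act : forall (X : C) (g : hom X (gr_arr G)) (p : hom X P),
    src G ∘ g = a ∘ p -> a ∘ act g p = tgt G ∘ g;
  act_unit : forall (X : C) (p : hom X P), act (unit_ G ∘ (a ∘ p)) p = p;
  act_gm : forall (X : C) (g h : hom X (gr_arr G)) (p : hom X P),
    src G ∘ g = tgt G ∘ h -> src G ∘ h = a ∘ p ->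
    act (g ⋅ h) p = act g (act h p)
}.

Section Actions.
Variables (C : site) (G : groupoid C) (P : C) (a : hom P (gr_ob G)).
Variable A : action a.

Lemma actKV (X : C) (g : hom X (gr_arr G)) (p : hom X P) :
  src G ∘ g = a ∘ p -> act A (inv G ∘ g) (act A g p) = p.
Proof.
by move=> e; rewrite -act_gm ?src_inv_el // gmVg e act_unit.
Qed.

Lemma actVK (X : C) (g : hom X (gr_arr G)) (p : hom X P) :
  tgt G ∘ g = a ∘ p -> act A g (act A (inv G ∘ g) p) = p.
Proof.
by move=> e; rewrite -act_gm ?src_inv_el ?tgt_inv_el // gmgV e act_unit.
Qed.

Definition simply_transitive (N : C) (b : hom P N) : Prop :=
  (forall (X : C) (g : hom X (gr_arr G)) (p : hom X P),
     src G ∘ g = a ∘ p -> b ∘ act A g p = b ∘ p) /\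
  (forall (X : C) (p q : hom X P), b ∘ p = b ∘ q ->
     exists! g : hom X (gr_arr G), src G ∘ g = a ∘ p /\ act A g p = q).

End Actions.

Definition transporter (C : site) (G : groupoid C) (P : C) (a : hom P (gr_ob G))
    (A : action a) (N : C) (b : hom P N) (T : simply_transitive A b) (X : C)
    (p q : hom X P) (e : b ∘ p = b ∘ q) : hom X (gr_arr G) :=
  proj1_sig (constructive_definite_description _ (proj2 T X p q e)).

Section Transporter.
Variables (C : site) (G : groupoid C) (P : C) (a : hom P (gr_ob G)).
Variables (A : action a) (N : C) (b : hom P N) (T : simply_transitive A b).

Lemma src_transporter (X : C) (p q : hom X P) (e : b ∘ p = b ∘ q) :
  src G ∘ transporter T e = a ∘ p.
Proof. by rewrite /transporter; case: constructive_definite_description => g []. Qed.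

Lemma act_transporter (X : C) (p q : hom X P) (e : b ∘ p = b ∘ q) :
  act A (transporter T e) p = q.
Proof. by rewrite /transporter; case: constructive_definite_description => g []. Qed.

Lemma tgt_transporter (X : C) (p q : hom X P) (e : b ∘ p = b ∘ q) :
  tgt G ∘ transporter T e = a ∘ q.
Proof. by rewrite -{2}(act_transporter e) anchor_act ?src_transporter. Qed.

Lemma simply_transitive_inj (X : C) (p : hom X P) (g g' : hom X (gr_arr G)) :
  src G ∘ g = a ∘ p -> src G ∘ g' = a ∘ p -> act A g p = act A g' p -> g = g'.
Proof.
move=> e e' E; have [h [_ hu]] := proj2 T _ p _ (eq_sym (proj1 T _ _ _ e)).
by rewrite -(hu g) // -(hu g').
Qed.

End Transporter.

(** * Bitorsors *)

(** A principal bibundle with the right action turned into a left action by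
    inversion. In this form exchanging the two groupoids is just exchanging
    the fields of the record. *)
Record bitorsor (C : site) (G H : groupoid C) := Bitorsor {
  bt_ob : C;
  lanc : hom bt_ob (gr_ob G);
  ranc : hom bt_ob (gr_ob H);
  lact_on : action lanc;
  ract_on : action ranc;
  lanc_submersion : submersion lanc;
  ranc_submersion : submersion ranc;
  lact_transitive : simply_transitive lact_on ranc;
  ract_transitive : simply_transitive ract_on lanc;
  acts_commute : forall (X : C) (g : hom X (gr_arr G)) (h : hom X (gr_arr H))
    (p : hom X bt_ob), src G ∘ g = lanc ∘ p -> src H ∘ h = ranc ∘ p ->
    act lact_on g (act ract_on h p) = act ract_on h (act lact_on g p)
}.

Arguments lanc {_ _ _} _.
Arguments ranc {_ _ _} _.
Arguments lact_on {_ _ _} _.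
Arguments ract_on {_ _ _} _.

Definition bitorsor_sym (C : site) (G H : groupoid C) (P : bitorsor G H) :
    bitorsor H G.
Proof.
refine (Bitorsor (ranc_submersion P) (lanc_submersion P)
  (ract_transitive P) (lact_transitive P) _).
by move=> X h g p eh eg; rewrite acts_commute.
Defined.

Section BitorsorOfBibundle.
Variables (C : site) (G H : groupoid C) (P : bibundle G H).

Let lop X (g : hom X (gr_arr G)) (p : hom X (bb_ob P)) : hom X (bb_ob P) :=
  papp (lact P) g p p.
Let rop X (h : hom X (gr_arr H)) (p : hom X (bb_ob P)) : hom X (bb_ob P) :=
  papp (ract P) p (inv H ∘ h) p.

Lemma bibundle_lact_eq X (g : hom X (gr_arr G)) (p : hom X (bb_ob P))
    (e : src G ∘ g = lmom P ∘ p) :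
  lop g p = lact P ∘ pb_pair (lpairs P) e.
Proof. exact: papp_eq. Qed.

Lemma bibundle_ract_eq X (h : hom X (gr_arr H)) (p : hom X (bb_ob P))
    (e : rmom P ∘ p = tgt H ∘ (inv H ∘ h)) :
  rop h p = ract P ∘ pb_pair (rpairs P) e.
Proof. exact: papp_eq. Qed.

Lemma lmom_lop X (g : hom X (gr_arr G)) (p : hom X (bb_ob P)) :
  src G ∘ g = lmom P ∘ p -> lmom P ∘ lop g p = tgt G ∘ g.
Proof.
by move=> e; rewrite (bibundle_lact_eq e) comp_assoc lmom_lact -comp_assoc pb_pair1.
Qed.

Lemma ract_composable X (h : hom X (gr_arr H)) (p : hom X (bb_ob P)) :
  src H ∘ h = rmom P ∘ p -> rmom P ∘ p = tgt H ∘ (inv H ∘ h).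
Proof. by rewrite tgt_inv_el. Qed.

Lemma rmom_rop X (h : hom X (gr_arr H)) (p : hom X (bb_ob P)) :
  src H ∘ h = rmom P ∘ p -> rmom P ∘ rop h p = tgt H ∘ h.
Proof.
move=> /ract_composable e.
by rewrite (bibundle_ract_eq e) comp_assoc rmom_ract -comp_assoc pb_pair2 src_inv_el.
Qed.

Definition bibundle_lact : action (lmom P).
Proof.
refine (@Action _ _ _ _ lop _ lmom_lop _ _).
- by move=> X Y g p u e; apply: papp_comp.
- by move=> X p; rewrite bibundle_lact_eq ?src_unit_el // => e; apply: lact_unit.
- move=> X g h p e1 e2.
  have e3 : src G ∘ (g ⋅ h) = lmom P ∘ p by rewrite src_gm.
  have e4 : src G ∘ g = lmom P ∘ lop h p by rewrite lmom_lop.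
  rewrite (bibundle_lact_eq e3) (bibundle_lact_eq e4).
  by move: e3 e4; rewrite -(gm_eq e1) (bibundle_lact_eq e2) => e3 e4; apply: lact_mul.
Defined.

Definition bibundle_ract : action (rmom P).
Proof.
refine (@Action _ _ _ _ rop _ rmom_rop _ _).
- by move=> X Y h p u /ract_composable e; rewrite /rop comp_assoc; apply: papp_comp.
- move=> X p; rewrite bibundle_ract_eq inv_unit ?tgt_unit_el // => e.
  exact: ract_unit.
- move=> X g h p e1 e2.
  have e0 : src H ∘ (inv H ∘ h) = tgt H ∘ (inv H ∘ g).
    by rewrite src_inv_el tgt_inv_el.
  have e3 : rmom P ∘ p = tgt H ∘ (inv H ∘ (g ⋅ h)).
    by rewrite tgt_inv_el src_gm.
  have e4 : rmom P ∘ rop h p = tgt H ∘ (inv H ∘ g).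
    by rewrite rmom_rop ?tgt_inv_el.
  rewrite (bibundle_ract_eq e3) (bibundle_ract_eq e4).
  move: e3 e4.
  rewrite inv_gm // -(gm_eq e0) (bibundle_ract_eq (ract_composable e2)) => e3 e4.
  by rewrite -(@ract_mul _ _ _ P _ _ _ _ _ e0 e4 e3).
Defined.

Lemma bitorsor_of_principal : principal P -> inhabited (bitorsor G H).
Proof.
move=> [[sr [PP1 /is_iso_elements iso1]] [sl [PP2 /is_iso_elements iso2]]].
split.
refine (@Bitorsor _ _ _ _ _ _ bibundle_lact bibundle_ract sl sr _ _ _).
- rewrite /bibundle_lact; split=> /= [X g p e | X p q e].
    by rewrite (bibundle_lact_eq e) comp_assoc rmom_lact -comp_assoc pb_pair2.
  have [w [w1 wu]] := iso1 X (pb_pair PP1 (eq_sym e)).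
  have lw := f_equal (comp (pb1 PP1)) w1.
  have rw := f_equal (comp (pb2 PP1)) w1.
  rewrite !comp_assoc !(pb_pair1, pb_pair2) in lw rw.
  have ew : src G ∘ (pb1 (lpairs P) ∘ w) = lmom P ∘ p.
    by rewrite -rw; apply: comp_eq; apply: pb_comm.
  exists (pb1 (lpairs P) ∘ w); split.
    split=> //; rewrite (bibundle_lact_eq ew) -lw.
    by congr (_ ∘ _); apply: pb_ext; rewrite ?pb_pair1 ?pb_pair2.
  move=> g [eg1 eg2]; rewrite (wu (pb_pair (lpairs P) eg1)) ?pb_pair1 //.
  apply: pb_ext; rewrite comp_assoc !(pb_pair1, pb_pair2) //.
  by rewrite -bibundle_lact_eq.
- rewrite /bibundle_ract; split=> /= [X h p /ract_composable e | X p q e].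
    by rewrite (bibundle_ract_eq e) comp_assoc lmom_ract -comp_assoc pb_pair1.
  have [w [w1 wu]] := iso2 X (pb_pair PP2 e).
  have lw := f_equal (comp (pb1 PP2)) w1.
  have rw := f_equal (comp (pb2 PP2)) w1.
  rewrite !comp_assoc !(pb_pair1, pb_pair2) in lw rw.
  have ew : rmom P ∘ p = tgt H ∘ (inv H ∘ (inv H ∘ (pb2 (rpairs P) ∘ w))).
    by rewrite inv_inv -lw; apply: comp_eq; apply: pb_comm.
  exists (inv H ∘ (pb2 (rpairs P) ∘ w)); split.
    split; first by rewrite ew tgt_inv_el.
    rewrite (bibundle_ract_eq ew) -rw; congr (_ ∘ _).
    by apply: pb_ext; rewrite ?pb_pair1 ?pb_pair2 ?inv_inv.
  move=> h [/ract_composable eh1 eh2]; rewrite (wu (pb_pair (rpairs P) eh1));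
    last by rewrite pb_pair2 inv_inv.
  apply: pb_ext; rewrite comp_assoc !(pb_pair1, pb_pair2) //.
  by rewrite -bibundle_ract_eq.
- rewrite /bibundle_lact /bibundle_ract /= => X g h p eg eh.
  have eh' : rmom P ∘ p = tgt H ∘ (inv H ∘ h) by rewrite tgt_inv_el.
  have e1 : rmom P ∘ lop g p = tgt H ∘ (inv H ∘ h).
    by rewrite (bibundle_lact_eq eg) comp_assoc rmom_lact -comp_assoc pb_pair2.
  have e2 : src G ∘ g = lmom P ∘ rop h p.
    by rewrite (bibundle_ract_eq eh') comp_assoc lmom_ract -comp_assoc pb_pair1.
  rewrite (bibundle_lact_eq e2) (bibundle_ract_eq e1).
  move: e1 e2; rewrite (bibundle_lact_eq eg) (bibundle_ract_eq eh') => e1 e2.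
  by rewrite (@act_commute _ _ _ P _ _ _ _ eg eh' e1 e2).
Qed.

End BitorsorOfBibundle.

Section BibundleOfBitorsor.
Variables (C : site) (G H : groupoid C) (P : bitorsor G H).
Variables (W1 : pullback (src G) (lanc P)) (W2 : pullback (ranc P) (tgt H)).

Let lop : hom W1 (bt_ob P) := act (lact_on P) (pb1 W1) (pb2 W1).
Let rop : hom W2 (bt_ob P) := act (ract_on P) (inv H ∘ pb2 W2) (pb1 W2).

Lemma lop_eq X (g : hom X (gr_arr G)) (p : hom X (bt_ob P))
    (e : src G ∘ g = lanc P ∘ p) :
  lop ∘ pb_pair W1 e = act (lact_on P) g p.
Proof.
refine (@natural_op_eq _ _ _ _ _ _ _ W1 (@act _ _ _ _ (lact_on P)) _ _ _ _ e).
exact: act_comp.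
Qed.

Lemma rop_eq X (p : hom X (bt_ob P)) (h : hom X (gr_arr H))
    (e : ranc P ∘ p = tgt H ∘ h) :
  rop ∘ pb_pair W2 e = act (ract_on P) (inv H ∘ h) p.
Proof.
refine (@natural_op_eq _ _ _ _ _ _ _ W2
  (fun X p h => act (ract_on P) (inv H ∘ h) p) _ _ _ _ e).
by move=> X' Y x y u e'; rewrite act_comp ?src_inv_el // comp_assoc.
Qed.

Lemma lop_pb : src G ∘ pb1 W1 = lanc P ∘ pb2 W1.
Proof. exact: pb_comm. Qed.

Lemma rop_pb : src H ∘ (inv H ∘ pb2 W2) = ranc P ∘ pb1 W2.
Proof. by rewrite src_inv_el pb_comm. Qed.

Definition bibundle_of_bitorsor : bibundle G H.
Proof.
refine (@Bibundle _ _ _ _ _ _ W1 lop W2 rop _ _ _ _ _ _ _ _ _).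
- by rewrite anchor_act ?lop_pb.
- by rewrite (proj1 (lact_transitive P)) ?lop_pb.
- by move=> X p e; rewrite lop_eq act_unit.
- move=> X g h p e_gh e_hp; rewrite gm_eq !lop_eq => e1 e2.
  by rewrite !lop_eq act_gm.
- by rewrite anchor_act ?rop_pb // tgt_inv_el.
- by rewrite (proj1 (ract_transitive P)) ?rop_pb.
- by move=> X p e; rewrite rop_eq inv_unit act_unit.
- move=> X p h k e_ph e_hk; rewrite gm_eq !rop_eq => e1 e2.
  by rewrite !rop_eq inv_gm // act_gm // ?src_inv_el ?tgt_inv_el.
- move=> X g p h e_gp e_ph; rewrite lop_eq rop_eq => e1 e2.
  by rewrite lop_eq rop_eq acts_commute // src_inv_el.
Defined.

Lemma principal_of_bitorsor : principal bibundle_of_bitorsor.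
Proof.
have [[PP1] [PP2]] := (proj1 (ranc_submersion P) _ (ranc P),
                       proj1 (lanc_submersion P) _ (lanc P)).
split; split; rewrite /=.
- exact: ranc_submersion.
- exists PP1; apply/is_iso_elements => X y.
  have e : ranc P ∘ (pb2 PP1 ∘ y) = ranc P ∘ (pb1 PP1 ∘ y).
    by apply: comp_eq; rewrite pb_comm.
  have [g [[g1 g2] gu]] := proj2 (lact_transitive P) _ _ _ e.
  exists (pb_pair W1 g1); split.
    apply: pb_ext; rewrite comp_assoc ?pb_pair1 ?pb_pair2 //.
    by rewrite lop_eq.
  move=> w ew.
  have e1 := f_equal (comp (pb1 PP1)) ew; have e2 := f_equal (comp (pb2 PP1)) ew.
  rewrite !comp_assoc pb_pair1 in e1; rewrite !comp_assoc pb_pair2 in e2.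
  apply: pb_ext; rewrite ?pb_pair1 ?pb_pair2 //; apply: gu.
  have e3 : src G ∘ (pb1 W1 ∘ w) = lanc P ∘ (pb2 W1 ∘ w) by apply: comp_eq; apply: pb_comm.
  by rewrite -e2; split=> //; rewrite -(lop_eq e3) pb_pair_eta e1.
- exact: lanc_submersion.
- exists PP2; apply/is_iso_elements => X y.
  have e : lanc P ∘ (pb1 PP2 ∘ y) = lanc P ∘ (pb2 PP2 ∘ y).
    by apply: comp_eq; rewrite pb_comm.
  have [h [[h1 h2] hu]] := proj2 (ract_transitive P) _ _ _ e.
  have h3 : ranc P ∘ (pb1 PP2 ∘ y) = tgt H ∘ (inv H ∘ h) by rewrite tgt_inv_el.
  exists (pb_pair W2 h3); split.
    apply: pb_ext; rewrite comp_assoc ?pb_pair1 ?pb_pair2 //.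
    by rewrite rop_eq inv_inv.
  move=> w ew.
  have e1 := f_equal (comp (pb1 PP2)) ew; have e2 := f_equal (comp (pb2 PP2)) ew.
  rewrite !comp_assoc pb_pair1 in e1; rewrite !comp_assoc pb_pair2 in e2.
  have e3 : ranc P ∘ (pb1 W2 ∘ w) = tgt H ∘ (pb2 W2 ∘ w) by apply: comp_eq; apply: pb_comm.
  apply: pb_ext; rewrite ?pb_pair1 ?pb_pair2 //.
  rewrite (hu (inv H ∘ (pb2 W2 ∘ w))) ?inv_inv // src_inv_el -e1 e3.
  by split=> //; rewrite -(rop_eq e3) pb_pair_eta.
Qed.

End BibundleOfBitorsor.

Lemma morita_equivalent_bitorsor (C : site) (G H : groupoid C) :
  morita_equivalent G H <-> inhabited (bitorsor G H).
Proof.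
split=> [[P /bitorsor_of_principal] // | [P]].
have [[W1] [W2]] := (proj1 (lanc_submersion P) _ (src G),
                     proj1 (tgt_submersion H) _ (ranc P)).
exists (bibundle_of_bitorsor W1 W2); exact: principal_of_bitorsor.
Qed.

(** * Weak equivalences on generalized elements *)

Lemma fully_faithful_elements (C : site) (G H : groupoid C)
    (F : groupoid_hom G H) :
  fully_faithful F ->
  forall (X : C) (x y : hom X (gr_ob G)) (h : hom X (gr_arr H)),
    tgt H ∘ h = hom_ob F ∘ x -> src H ∘ h = hom_ob F ∘ y ->
    exists! g : hom X (gr_arr G),
      tgt G ∘ g = x /\ src G ∘ g = y /\ hom_arr F ∘ g = h.
Proof.
move=> [A [B /is_iso_elements iso]] X x y h ex ey.
pose w := pb_pair A (eq_sym ex).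
have ew : src H ∘ pb2 A ∘ w = hom_ob F ∘ y by rewrite -comp_assoc pb_pair2.
have [g [g1 gu]] := iso X (pb_pair B ew).
have E X' (g' : hom X' (gr_arr G)) :
    pb1 A ∘ (pb1 B ∘ (pb_pair B (hom_triple_eq A) ∘ g')) = tgt G ∘ g' /\
    pb2 A ∘ (pb1 B ∘ (pb_pair B (hom_triple_eq A) ∘ g')) = hom_arr F ∘ g' /\
    pb2 B ∘ (pb_pair B (hom_triple_eq A) ∘ g') = src G ∘ g'.
  by rewrite !(comp_assoc (pb1 B)) !(comp_assoc (pb2 B)) pb_pair1 pb_pair2
    !(comp_assoc (pb1 A)) !(comp_assoc (pb2 A)) pb_pair1 pb_pair2.
exists g; split.
- have [<- [<- <-]] := E X g; rewrite g1.
  by rewrite pb_pair1 pb_pair2 /w pb_pair1 pb_pair2.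
- move=> g' [e1 [e2 e3]]; apply: gu.
  have [E1 [E2 E3]] := E X g'.
  apply: pb_ext; rewrite ?pb_pair1 ?pb_pair2; last by rewrite E3.
  by apply: pb_ext; rewrite /w ?pb_pair1 ?pb_pair2 ?E1 ?E2.
Qed.

(** When [F] is a submersion on objects, the fiber products in the definition
    of a weak equivalence exist, and essential surjectivity holds because
    submersions are stable under base change and composition. *)
Lemma weak_equivalence_of_elements (C : site) (G H : groupoid C)
    (F : groupoid_hom G H) :
  submersion (hom_ob F) ->
  (forall (X : C) (x y : hom X (gr_ob G)) (h : hom X (gr_arr H)),
     tgt H ∘ h = hom_ob F ∘ x -> src H ∘ h = hom_ob F ∘ y ->
     exists! g : hom X (gr_arr G),
       tgt G ∘ g = x /\ src G ∘ g = y /\ hom_arr F ∘ g = h) ->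
  weak_equivalence F.
Proof.
move=> sF ff; split.
- have [E] := proj1 sF _ (src H).
  exists E; apply: submersion_comp (tgt_submersion H) _.
  exact: submersion_pb1.
- have [A] := proj1 (tgt_submersion H) _ (hom_ob F).
  have [B] := proj1 sF _ (src H ∘ pb2 A).
  exists A, B; apply/is_iso_elements => X w.
  have ex : tgt H ∘ (pb2 A ∘ (pb1 B ∘ w)) = hom_ob F ∘ (pb1 A ∘ (pb1 B ∘ w)).
    by apply: comp_eq; rewrite pb_comm.
  have ey : src H ∘ (pb2 A ∘ (pb1 B ∘ w)) = hom_ob F ∘ (pb2 B ∘ w).
    by rewrite comp_assoc; apply: comp_eq; rewrite pb_comm.
  have [g [[g1 [g2 g3]] gu]] := ff X _ _ _ ex ey.
  exists g; split.
    apply: pb_ext; rewrite comp_assoc ?pb_pair1 ?pb_pair2 //.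
    by apply: pb_ext; rewrite comp_assoc ?pb_pair1 ?pb_pair2.
  move=> g' eg'; apply: gu.
  rewrite -eg' !(comp_assoc (pb1 B)) !(comp_assoc (pb2 B)) !pb_pair1 !pb_pair2.
  by rewrite !comp_assoc !pb_pair1 !pb_pair2.
Qed.

(** * From bitorsors to weak equivalences *)

Section BitorsorGroupoid.
Variables (C : site) (hC : good_site C) (G H : groupoid C) (P : bitorsor G H).
Variable WG : pullback (src G) (lanc P).
Variable WH : pullback (src H) (ranc P ∘ pb2 WG).

(** The components [g], [h] and [p] of an arrow [(g, h, p)], and its target
    [g h p]. *)
Let kg : hom WH (gr_arr G) := pb1 WG ∘ pb2 WH.
Let kh : hom WH (gr_arr H) := pb1 WH.
Let kp : hom WH (bt_ob P) := pb2 WG ∘ pb2 WH.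
Let kt : hom WH (bt_ob P) := act (lact_on P) kg (act (ract_on P) kh kp).

Lemma triple_ext X (x y : hom X WH) :
  kg ∘ x = kg ∘ y -> kh ∘ x = kh ∘ y -> kp ∘ x = kp ∘ y -> x = y.
Proof.
rewrite /kg /kp -!comp_assoc => eg eh ep.
by apply: pb_ext => //; apply: pb_ext.
Qed.

Lemma triple_exists X (g : hom X (gr_arr G)) (h : hom X (gr_arr H))
    (p : hom X (bt_ob P)) :
  src G ∘ g = lanc P ∘ p -> src H ∘ h = ranc P ∘ p ->
  exists x : hom X WH, kg ∘ x = g /\ kh ∘ x = h /\ kp ∘ x = p.
Proof.
move=> eg eh.
have eh' : src H ∘ h = ranc P ∘ pb2 WG ∘ pb_pair WG eg.
  by rewrite -comp_assoc pb_pair2.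
exists (pb_pair WH eh').
by rewrite /kg /kp -!comp_assoc /kh !pb_pair1 !pb_pair2 pb_pair1.
Qed.

Lemma src_kg X (x : hom X WH) : src G ∘ (kg ∘ x) = lanc P ∘ (kp ∘ x).
Proof. by apply: comp_eq; rewrite /kg /kp !comp_assoc pb_comm. Qed.

Lemma src_kh X (x : hom X WH) : src H ∘ (kh ∘ x) = ranc P ∘ (kp ∘ x).
Proof. by apply: comp_eq; rewrite /kh /kp comp_assoc pb_comm. Qed.

Lemma kt_eq X (x : hom X WH) :
  kt ∘ x = act (lact_on P) (kg ∘ x) (act (ract_on P) (kh ∘ x) (kp ∘ x)).
Proof.
have := src_kg (idm WH); have := src_kh (idm WH); rewrite !comp_idr => eh eg.
by rewrite /kt !act_comp // (proj1 (ract_transitive P)).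
Qed.

Lemma lanc_kt X (x : hom X WH) : lanc P ∘ (kt ∘ x) = tgt G ∘ (kg ∘ x).
Proof.
by rewrite kt_eq anchor_act // (proj1 (ract_transitive P)) ?src_kg // src_kh.
Qed.

Lemma ranc_kt X (x : hom X WH) : ranc P ∘ (kt ∘ x) = tgt H ∘ (kh ∘ x).
Proof.
rewrite kt_eq (proj1 (lact_transitive P)) ?anchor_act ?src_kh //.
by rewrite (proj1 (ract_transitive P)) ?src_kg // src_kh.
Qed.

Lemma kp_submersion : submersion kp.
Proof.
apply: submersion_comp.
- exact: submersion_pb2 (src_submersion G).
- exact: submersion_pb2 (src_submersion H).
Qed.

Variable WK : pullback kp kt.

Lemma triple_mul_exists :
  exists m : hom WK WH, kg ∘ m = (kg ∘ pb1 WK) ⋅ (kg ∘ pb2 WK) /\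
    kh ∘ m = (kh ∘ pb1 WK) ⋅ (kh ∘ pb2 WK) /\ kp ∘ m = kp ∘ pb2 WK.
Proof.
have eg : src G ∘ (kg ∘ pb1 WK) = tgt G ∘ (kg ∘ pb2 WK).
  by rewrite src_kg pb_comm lanc_kt.
have eh : src H ∘ (kh ∘ pb1 WK) = tgt H ∘ (kh ∘ pb2 WK).
  by rewrite src_kh pb_comm ranc_kt.
by apply: triple_exists; rewrite src_gm // ?src_kg ?src_kh.
Qed.

Lemma triple_unit_exists :
  exists u : hom (bt_ob P) WH, kg ∘ u = unit_ G ∘ lanc P /\
    kh ∘ u = unit_ H ∘ ranc P /\ kp ∘ u = idm _.
Proof. by apply: triple_exists; rewrite ?src_unit_el comp_idr. Qed.

Lemma triple_inv_exists :
  exists i : hom WH WH, kg ∘ i = inv G ∘ kg /\ kh ∘ i = inv H ∘ kh /\ kp ∘ i = kt.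
Proof.
apply: triple_exists; rewrite src_inv_el.
- by have := lanc_kt (idm WH); rewrite !comp_idr.
- by have := ranc_kt (idm WH); rewrite !comp_idr.
Qed.

Let kmul := proj1_sig (constructive_indefinite_description _ triple_mul_exists).
Let kunit := proj1_sig (constructive_indefinite_description _ triple_unit_exists).
Let kinv := proj1_sig (constructive_indefinite_description _ triple_inv_exists).

Section Products.
Variables (X : C) (x y : hom X WH) (e : kp ∘ x = kt ∘ y).

Lemma kg_composable : src G ∘ (kg ∘ x) = tgt G ∘ (kg ∘ y).
Proof. by rewrite src_kg e lanc_kt. Qed.

Lemma kh_composable : src H ∘ (kh ∘ x) = tgt H ∘ (kh ∘ y).
Proof. by rewrite src_kh e ranc_kt. Qed.

Lemma kmul_eq :
  kg ∘ (kmul ∘ pb_pair WK e) = (kg ∘ x) ⋅ (kg ∘ y) /\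
  kh ∘ (kmul ∘ pb_pair WK e) = (kh ∘ x) ⋅ (kh ∘ y) /\
  kp ∘ (kmul ∘ pb_pair WK e) = kp ∘ y.
Proof.
rewrite (comp_assoc kg) (comp_assoc kh) (comp_assoc kp) /kmul.
case: constructive_indefinite_description => m /= [-> [-> ->]].
rewrite !gm_comp.
- by rewrite src_kg pb_comm lanc_kt.
- by rewrite src_kh pb_comm ranc_kt.
- by rewrite -!(comp_assoc kg) -!(comp_assoc kh) -(comp_assoc kp) pb_pair1 pb_pair2.
Qed.

(** [(g' g) (h' h) p = g' h' (g h p)], since the actions commute. *)
Lemma kt_kmul : kt ∘ (kmul ∘ pb_pair WK e) = kt ∘ x.
Proof.
have [eg [eh ep]] := kmul_eq.
have e1 := kg_composable; have e2 := kh_composable.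
have e3 := src_kg y; have e4 := src_kh y.
have e5 : src G ∘ (kg ∘ y) = lanc P ∘ act (ract_on P) (kh ∘ y) (kp ∘ y).
  by rewrite (proj1 (ract_transitive P)) // src_kg.
have e6 : src H ∘ (kh ∘ x) = ranc P ∘ act (ract_on P) (kh ∘ y) (kp ∘ y).
  by rewrite anchor_act.
rewrite (kt_eq x) e (kt_eq y) kt_eq eg eh ep act_gm ?(act_gm _ e2) //.
- by rewrite (proj1 (ract_transitive P)).
- by rewrite acts_commute.
Qed.

End Products.

Lemma kunit_eq X (p : hom X (bt_ob P)) :
  kg ∘ (kunit ∘ p) = unit_ G ∘ (lanc P ∘ p) /\
  kh ∘ (kunit ∘ p) = unit_ H ∘ (ranc P ∘ p) /\ kp ∘ (kunit ∘ p) = p.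
Proof.
rewrite (comp_assoc kg) (comp_assoc kh) (comp_assoc kp) /kunit.
case: constructive_indefinite_description => u /= [-> [-> ->]].
by rewrite -!(comp_assoc (unit_ _)) comp_idl.
Qed.

Lemma kinv_eq X (x : hom X WH) :
  kg ∘ (kinv ∘ x) = inv G ∘ (kg ∘ x) /\
  kh ∘ (kinv ∘ x) = inv H ∘ (kh ∘ x) /\ kp ∘ (kinv ∘ x) = kt ∘ x.
Proof.
rewrite (comp_assoc kg) (comp_assoc kh) (comp_assoc kp) /kinv.
case: constructive_indefinite_description => i /= [-> [-> ->]].
by rewrite -!(comp_assoc (inv _)).
Qed.

Lemma kt_kinv X (x : hom X WH) : kt ∘ (kinv ∘ x) = kp ∘ x.
Proof.
have [eg [eh ep]] := kinv_eq x.
have e3 := src_kg x; have e4 := src_kh x.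
have e5 : src G ∘ (kg ∘ x) = lanc P ∘ act (ract_on P) (kh ∘ x) (kp ∘ x).
  by rewrite (proj1 (ract_transitive P)).
have e6 : src H ∘ (inv H ∘ (kh ∘ x)) = ranc P ∘ act (ract_on P) (kh ∘ x) (kp ∘ x).
  by rewrite anchor_act // src_inv_el.
by rewrite kt_eq eg eh ep kt_eq -acts_commute // !actKV.
Qed.

Lemma kt_kunit X (p : hom X (bt_ob P)) : kt ∘ (kunit ∘ p) = p.
Proof.
have [eg [eh ep]] := kunit_eq p.
by rewrite kt_eq eg eh ep !act_unit.
Qed.

Definition bitorsor_groupoid : groupoid C.
Proof.
refine (@Groupoid C _ _ kp kt kp_submersion _ WK kmul kunit kinv
  _ _ _ _ _ _ _ _ _ _ _).
- apply: (GS5 hC (g := kinv)); have := kt_kinv (idm WH); rewrite !comp_idr => ->.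
  exact: kp_submersion.
- by have [_ [_]] := kmul_eq (pb_comm WK); rewrite pb_pair_generic comp_idr.
- by have := kt_kmul (pb_comm WK); rewrite pb_pair_generic comp_idr.
- by have [_ [_]] := kunit_eq (idm _); rewrite comp_idr.
- by have := kt_kunit (idm _); rewrite comp_idr.
- by have [_ [_]] := kinv_eq (idm _); rewrite !comp_idr.
- by have := kt_kinv (idm _); rewrite !comp_idr.
- move=> X x y z exy eyz e1 e2.
  have [g1 [h1 p1]] := kmul_eq e1; have [g2 [h2 p2]] := kmul_eq e2.
  have [g3 [h3 p3]] := kmul_eq exy; have [g4 [h4 p4]] := kmul_eq eyz.
  apply: triple_ext; rewrite ?g1 ?g2 ?g3 ?g4 ?h1 ?h2 ?h3 ?h4 ?p1 ?p2 ?p4 //.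
  + by rewrite gmA //; apply: kg_composable.
  + by rewrite gmA //; apply: kh_composable.
- move=> X x e.
  have [g1 [h1 p1]] := kmul_eq e; have [g2 [h2 p2]] := kunit_eq (kt ∘ x).
  apply: triple_ext; rewrite ?g1 ?h1 ?p1 ?g2 ?h2 //.
  + by rewrite lanc_kt gm1g.
  + by rewrite ranc_kt gm1g.
- move=> X x e.
  have [g1 [h1 p1]] := kmul_eq e; have [g2 [h2 p2]] := kunit_eq (kp ∘ x).
  apply: triple_ext; rewrite ?g1 ?h1 ?p1 ?g2 ?h2 ?p2 //.
  + by rewrite -src_kg gmg1.
  + by rewrite -src_kh gmg1.
- move=> X x e.
  have [g1 [h1 p1]] := kmul_eq e; have [g2 [h2 p2]] := kunit_eq (kp ∘ x).
  have [g3 [h3 p3]] := kinv_eq x.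
  apply: triple_ext; rewrite ?g1 ?h1 ?p1 ?g2 ?h2 ?p2 ?g3 ?h3 //.
  + by rewrite gmVg src_kg.
  + by rewrite gmVg src_kh.
- move=> X x e.
  have [g1 [h1 p1]] := kmul_eq e; have [g2 [h2 p2]] := kunit_eq (kt ∘ x).
  have [g3 [h3 p3]] := kinv_eq x.
  apply: triple_ext; rewrite ?g1 ?h1 ?p1 ?g2 ?h2 ?p2 ?g3 ?h3 ?p3 //.
  + by rewrite gmgV lanc_kt.
  + by rewrite gmgV ranc_kt.
Defined.

Definition bitorsor_groupoid_left : groupoid_hom bitorsor_groupoid G.
Proof.
refine (@GroupoidHom _ bitorsor_groupoid G (lanc P) kg _ _ _ _).
- by have := src_kg (idm _); rewrite !comp_idr.
- by have := lanc_kt (idm _); rewrite !comp_idr.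
- by have [] := kunit_eq (idm _); rewrite !comp_idr.
- by move=> X x y e e'; have [-> _] := kmul_eq e; rewrite gm_eq.
Defined.

Definition bitorsor_groupoid_right : groupoid_hom bitorsor_groupoid H.
Proof.
refine (@GroupoidHom _ bitorsor_groupoid H (ranc P) kh _ _ _ _).
- by have := src_kh (idm _); rewrite !comp_idr.
- by have := ranc_kt (idm _); rewrite !comp_idr.
- by have [_ []] := kunit_eq (idm _); rewrite !comp_idr.
- by move=> X x y e e'; have [_ [-> _]] := kmul_eq e; rewrite gm_eq.
Defined.

(** An arrow [(g, h, p)] is determined by [g], [p] and [q = g h p], because
    [h] is the unique element with [h p = g^-1 q]. *)
Lemma bitorsor_groupoid_left_weak : weak_equivalence bitorsor_groupoid_left.
Proof.
apply: weak_equivalence_of_elements => [|X q p g /= eq ep].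
  exact: lanc_submersion.
have [inv_r tr_r] := ract_transitive P; have [inv_l tr_l] := lact_transitive P.
have eV : src G ∘ (inv G ∘ g) = lanc P ∘ q by rewrite src_inv_el.
have e0 : lanc P ∘ p = lanc P ∘ act (lact_on P) (inv G ∘ g) q.
  by rewrite anchor_act // tgt_inv_el.
have [h [[h1 h2] hu]] := tr_r _ _ _ e0.
have [x [xg [xh xp]]] := triple_exists ep h1.
exists x; split.
  by rewrite kt_eq xg xh xp h2 actVK.
move=> y [yt [yp yg]]; apply: triple_ext; rewrite ?xg ?xh ?xp ?yp ?yg //.
apply: hu; rewrite src_kh yp; split=> //.
rewrite -yt kt_eq yg yp actKV // inv_r // -yp src_kh //.
Qed.

(** Likewise [g] is the unique element with [g (h p) = q]. *)
Lemma bitorsor_groupoid_right_weak : weak_equivalence bitorsor_groupoid_right.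
Proof.
apply: weak_equivalence_of_elements => [|X q p h /= eq ep].
  exact: ranc_submersion.
have [inv_r tr_r] := ract_transitive P; have [inv_l tr_l] := lact_transitive P.
have eh : ranc P ∘ act (ract_on P) h p = ranc P ∘ q by rewrite anchor_act.
have [g [[g1 g2] gu]] := tr_l _ _ _ eh.
rewrite inv_r // in g1.
have [x [xg [xh xp]]] := triple_exists g1 ep.
exists x; split.
  by rewrite kt_eq xg xh xp g2.
move=> y [yt [yp yh]]; apply: triple_ext; rewrite ?xg ?xh ?xp ?yp ?yh //.
by apply: gu; rewrite src_kg inv_r // -yt kt_eq yp yh.
Qed.

End BitorsorGroupoid.

Lemma weak_equivalences_of_bitorsor (C : site) (hC : good_site C)
    (G H : groupoid C) (P : bitorsor G H) :
  exists (K : groupoid C) (F1 : groupoid_hom K H) (F2 : groupoid_hom K G),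
    weak_equivalence F1 /\ weak_equivalence F2.
Proof.
have [WG] := proj1 (lanc_submersion P) _ (src G).
have [WH'] := proj1 (src_submersion H) _ (ranc P ∘ pb2 WG).
pose WH := pullback_sym WH'.
have [WK] := proj1 (kp_submersion WH) _
  (act (lact_on P) (pb1 WG ∘ pb2 WH)
    (act (ract_on P) (pb1 WH) (pb2 WG ∘ pb2 WH))).
exists (bitorsor_groupoid hC (pullback_sym WK)).
eexists; eexists; split.
- exact: bitorsor_groupoid_right_weak.
- exact: bitorsor_groupoid_left_weak.
Qed.

(** * From weak equivalences to bitorsors *)

Section BitorsorOfWeakEquivalence.
Variables (C : site) (K G : groupoid C) (F : groupoid_hom K G).

Lemma src_hom_el X (k : hom X (gr_arr K)) :
  src G ∘ (hom_arr F ∘ k) = hom_ob F ∘ (src K ∘ k).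
Proof. exact: comp_eq (hom_src F). Qed.

Lemma tgt_hom_el X (k : hom X (gr_arr K)) :
  tgt G ∘ (hom_arr F ∘ k) = hom_ob F ∘ (tgt K ∘ k).
Proof. by apply: comp_eq; rewrite hom_tgt. Qed.

Lemma hom_gm X (k l : hom X (gr_arr K)) :
  src K ∘ k = tgt K ∘ l ->
  hom_arr F ∘ (k ⋅ l) = (hom_arr F ∘ k) ⋅ (hom_arr F ∘ l).
Proof.
move=> e.
have e' : src G ∘ (hom_arr F ∘ k) = tgt G ∘ (hom_arr F ∘ l).
  by rewrite src_hom_el tgt_hom_el e.
by rewrite -(gm_eq e) (hom_mul e e') gm_eq.
Qed.

Variable E : pullback (src G) (hom_ob F).

(** An element of [E] is a pair of [ga] in [G] and [ox] in the base of [K], with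
    [src ga = F ox]. The actions below are [g (ga, ox) = (g ga, ox)]
    and [k (ga, ox) = (ga F(k)^-1, tgt k)]. *)
Let ga X (e : hom X E) : hom X (gr_arr G) := pb1 E ∘ e.
Let ox X (e : hom X E) : hom X (gr_ob K) := pb2 E ∘ e.

Lemma src_ga X (e : hom X E) : src G ∘ ga e = hom_ob F ∘ ox e.
Proof. by apply: comp_eq; apply: pb_comm. Qed.

Let pairE X (g : hom X (gr_arr G)) (x : hom X (gr_ob K)) (z : hom X E) : hom X E :=
  papp (idm E) g x z.

Lemma pairE_ga X (g : hom X (gr_arr G)) x z :
  src G ∘ g = hom_ob F ∘ x -> ga (pairE g x z) = g.
Proof. by move=> e; rewrite /pairE (papp_eq _ _ e) comp_idl /ga pb_pair1. Qed.

Lemma pairE_ox X (g : hom X (gr_arr G)) x z :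
  src G ∘ g = hom_ob F ∘ x -> ox (pairE g x z) = x.
Proof. by move=> e; rewrite /pairE (papp_eq _ _ e) comp_idl /ox pb_pair2. Qed.

Let gop X (g : hom X (gr_arr G)) (e : hom X E) : hom X E :=
  pairE (g ⋅ ga e) (ox e) e.
Let kop X (k : hom X (gr_arr K)) (e : hom X E) : hom X E :=
  pairE (ga e ⋅ (inv G ∘ (hom_arr F ∘ k))) (tgt K ∘ k) e.

Lemma gop_eq X (g : hom X (gr_arr G)) (e : hom X E) :
  src G ∘ g = (tgt G ∘ pb1 E) ∘ e ->
  ga (gop g e) = g ⋅ ga e /\ ox (gop g e) = ox e.
Proof.
rewrite -comp_assoc => eg.
have e' : src G ∘ (g ⋅ ga e) = hom_ob F ∘ ox e by rewrite src_gm // src_ga.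
by rewrite /gop pairE_ga // pairE_ox.
Qed.

Lemma kop_composable X (k : hom X (gr_arr K)) (e : hom X E) :
  src K ∘ k = pb2 E ∘ e ->
  src G ∘ ga e = tgt G ∘ (inv G ∘ (hom_arr F ∘ k)).
Proof. by move=> ek; rewrite tgt_inv_el src_hom_el src_ga ek. Qed.

Lemma kop_eq X (k : hom X (gr_arr K)) (e : hom X E) :
  src K ∘ k = pb2 E ∘ e ->
  ga (kop k e) = ga e ⋅ (inv G ∘ (hom_arr F ∘ k)) /\ ox (kop k e) = tgt K ∘ k.
Proof.
move=> ek.
have e' : src G ∘ (ga e ⋅ (inv G ∘ (hom_arr F ∘ k))) = hom_ob F ∘ (tgt K ∘ k).
  by rewrite (src_gm (kop_composable ek)) src_inv_el tgt_hom_el.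
by rewrite /kop pairE_ga // pairE_ox.
Qed.

Definition weak_lact : action (tgt G ∘ pb1 E).
Proof.
refine (@Action _ _ _ _ gop _ _ _ _).
- move=> X Y g e u eg.
  have eu : src G ∘ (g ∘ u) = (tgt G ∘ pb1 E) ∘ (e ∘ u) by apply: comp_eq.
  have [e1 e2] := gop_eq eg; have [e3 e4] := gop_eq eu.
  rewrite /ga /ox in e1 e2 e3 e4.
  apply: pb_ext; rewrite ?e3 ?e4 comp_assoc ?e1 ?e2 -?comp_assoc //.
  by rewrite gm_comp ?comp_assoc // eg !comp_assoc.
- move=> X g e eg; have [e1 e2] := gop_eq eg.
  rewrite -comp_assoc [pb1 E ∘ _]e1 tgt_gm //; by rewrite eg -comp_assoc.
- move=> X e.
  have [|e1 e2] := gop_eq (g := unit_ G ∘ ((tgt G ∘ pb1 E) ∘ e)) (e := e).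
    by rewrite src_unit_el.
  apply: pb_ext; first by rewrite [LHS]e1 -comp_assoc gm1g.
  exact: e2.
- move=> X g h e egh eh; have [e1 e2] := gop_eq eh.
  have egh' : src G ∘ (g ⋅ h) = (tgt G ∘ pb1 E) ∘ e by rewrite src_gm.
  have eg' : src G ∘ g = (tgt G ∘ pb1 E) ∘ gop h e.
    rewrite -comp_assoc [pb1 E ∘ _]e1 tgt_gm //; by rewrite eh -comp_assoc.
  have [e3 e4] := gop_eq egh'; have [e5 e6] := gop_eq eg'.
  apply: pb_ext; first by rewrite [LHS]e3 [RHS]e5 e1 gmA // eh -comp_assoc.
  by rewrite [LHS]e4 [RHS]e6 e2.
Defined.

Definition weak_ract : action (pb2 E).
Proof.
refine (@Action _ _ _ _ kop _ _ _ _).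
- move=> X Y k e u ek.
  have eu : src K ∘ (k ∘ u) = pb2 E ∘ (e ∘ u) by apply: comp_eq.
  have [e1 e2] := kop_eq ek; have [e3 e4] := kop_eq eu.
  rewrite /ga /ox in e1 e2 e3 e4.
  apply: pb_ext; rewrite ?e3 ?e4 comp_assoc ?e1 ?e2 -?comp_assoc //.
  by rewrite gm_comp -?comp_assoc //; apply: kop_composable.
- by move=> X k e /kop_eq [].
- move=> X e.
  have [|e1 e2] := kop_eq (k := unit_ K ∘ (pb2 E ∘ e)) (e := e).
    by rewrite src_unit_el.
  apply: pb_ext; last by rewrite [LHS]e2 tgt_unit_el.
  rewrite [LHS]e1 (comp_assoc (hom_arr F)) hom_unit -comp_assoc inv_unit.
  by rewrite -[_ ∘ (pb2 E ∘ e)]src_ga gmg1.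
- move=> X k l e ekl el; have [e1 e2] := kop_eq el.
  have ekl' : src K ∘ (k ⋅ l) = pb2 E ∘ e by rewrite src_gm.
  have ek' : src K ∘ k = pb2 E ∘ kop l e by rewrite [RHS]e2.
  have [e3 e4] := kop_eq ekl'; have [e5 e6] := kop_eq ek'.
  have ef : src G ∘ (hom_arr F ∘ k) = tgt G ∘ (hom_arr F ∘ l).
    by rewrite src_hom_el tgt_hom_el ekl.
  apply: pb_ext; last by rewrite [LHS]e4 [RHS]e6 tgt_gm.
  rewrite [LHS]e3 [RHS]e5 e1 hom_gm // inv_gm // gmA //.
  + exact: kop_composable.
  + by rewrite src_inv_el tgt_inv_el.
Defined.

(** Two pairs [(g, x)] and [(g', x')] with [tgt g = tgt g'] differ by the arrow
    from [x] to [x'] that full faithfulness assigns to [g'^-1 g]; two pairs with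
    [x = x'] differ by [g' g^-1]. *)
Lemma bitorsor_of_weak_equivalence :
  submersion (tgt G ∘ pb1 E) -> fully_faithful F -> inhabited (bitorsor G K).
Proof.
move=> sE ff; split.
refine (@Bitorsor _ _ _ E _ _ weak_lact weak_ract sE _ _ _ _).
- exact: submersion_pb2 (src_submersion G).
- rewrite /weak_lact; split=> /= [X g e eg | X e e' ee].
    by have [_] := gop_eq eg.
  have eV : src G ∘ ga e' = tgt G ∘ (inv G ∘ ga e).
    by rewrite tgt_inv_el !src_ga /ox ee.
  have eg : src G ∘ (ga e' ⋅ (inv G ∘ ga e)) = (tgt G ∘ pb1 E) ∘ e.
    by rewrite src_gm // src_inv_el -comp_assoc.
  have [e1 e2] := gop_eq eg.
  exists (ga e' ⋅ (inv G ∘ ga e)); split.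
    split=> //; apply: pb_ext; last by rewrite [LHS]e2.
    by rewrite [LHS]e1 gmVKr // !src_ga /ox ee.
  move=> g [eg1 eg2]; have [e3 _] := gop_eq eg1.
  by rewrite -eg2 e3 gmK // eg1 -comp_assoc.
- rewrite /weak_ract; split=> /= [X k e ek | X e e' ee].
    have [e1 _] := kop_eq ek.
    by rewrite -comp_assoc [pb1 E ∘ _]e1 tgt_gm -?comp_assoc //; apply: kop_composable.
  have ee' : tgt G ∘ ga e = tgt G ∘ ga e' by rewrite /ga !comp_assoc.
  have eV : src G ∘ (inv G ∘ ga e') = tgt G ∘ ga e by rewrite src_inv_el.
  have [||k [[k1 [k2 k3]] ku]] := fully_faithful_elements ff
    (x := ox e') (y := ox e) (h := (inv G ∘ ga e') ⋅ ga e).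
  + by rewrite tgt_gm // tgt_inv_el src_ga.
  + by rewrite src_gm // src_ga.
  + exists k; split.
    split=> //; have [e1 e2] := kop_eq k2.
    apply: pb_ext; last by rewrite [LHS]e2.
    rewrite [LHS]e1 k3 inv_gm // inv_inv gmVK //.
  move=> l [l1 l2]; have [e1 e2] := kop_eq l1.
  have e3 := kop_composable l1.
  apply: ku; rewrite -e2 l2; split=> //; split=> //.
  by rewrite -l2 e1 inv_gm // inv_inv gmVKr // src_hom_el src_ga l1.
- rewrite /weak_lact /weak_ract /= => X g k e eg ek.
  have [e1 e2] := gop_eq eg; have [e3 e4] := kop_eq ek.
  have e0 := kop_composable ek.
  have eg' : src G ∘ g = (tgt G ∘ pb1 E) ∘ kop k e.
    by rewrite -comp_assoc [pb1 E ∘ _]e3 tgt_gm // eg -comp_assoc.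
  have ek' : src K ∘ k = pb2 E ∘ gop g e by rewrite [RHS]e2.
  have [e5 e6] := gop_eq eg'; have [e7 e8] := kop_eq ek'.
  apply: pb_ext; last by rewrite [LHS]e6 [RHS]e8.
  by rewrite [LHS]e5 [RHS]e7 e1 e3 gmA // eg -comp_assoc.
Qed.

End BitorsorOfWeakEquivalence.

(** * Composition of bitorsors *)

(** [Cl p q r] says that [r] is the class of the pair [(p, q)] in the quotient
    [R] of [P ×_K Q] by the diagonal action of [K]. The fields are symmetric in
    [P] and [Q]. *)
Record is_tensor (C : site) (G K H : groupoid C) (P : bitorsor G K)
    (Q : bitorsor K H) (R : C)
    (Cl : forall X : C, hom X (bt_ob P) -> hom X (bt_ob Q) -> hom X R -> Prop) :
    Prop := IsTensor {
  tensor_comp : forall (X Y : C) (p : hom X (bt_ob P)) (q : hom X (bt_ob Q))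
    (r : hom X R) (u : hom Y X), Cl X p q r -> Cl Y (p ∘ u) (q ∘ u) (r ∘ u);
  tensor_fiber : forall (X : C) (p : hom X (bt_ob P)) (q : hom X (bt_ob Q))
    (r : hom X R), Cl X p q r -> ranc P ∘ p = lanc Q ∘ q;
  tensor_functional : forall (X : C) (p : hom X (bt_ob P)) (q : hom X (bt_ob Q))
    (r r' : hom X R), Cl X p q r -> Cl X p q r' -> r = r';
  tensor_total : forall (X : C) (p : hom X (bt_ob P)) (q : hom X (bt_ob Q)),
    ranc P ∘ p = lanc Q ∘ q -> exists r : hom X R, Cl X p q r;
  tensor_invariant : forall (X : C) (p : hom X (bt_ob P)) (q : hom X (bt_ob Q))
    (r : hom X R) (k : hom X (gr_arr K)), src K ∘ k = ranc P ∘ p ->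
    Cl X p q r -> Cl X (act (ract_on P) k p) (act (lact_on Q) k q) r;
  tensor_orbit : forall (X : C) (p p' : hom X (bt_ob P)) (q q' : hom X (bt_ob Q))
    (r : hom X R), Cl X p q r -> Cl X p' q' r ->
    exists k : hom X (gr_arr K), src K ∘ k = ranc P ∘ p /\
      act (ract_on P) k p = p' /\ act (lact_on Q) k q = q';
  tensor_surjective : forall (X : C) (r : hom X R),
    locally (fun U (v : hom U X) => exists p q, Cl U p q (r ∘ v))
}.

Lemma is_tensor_sym (C : site) (G K H : groupoid C) (P : bitorsor G K)
    (Q : bitorsor K H) (R : C)
    (Cl : forall X : C, hom X (bt_ob P) -> hom X (bt_ob Q) -> hom X R -> Prop) :
  is_tensor Cl ->
  @is_tensor C H K G (bitorsor_sym Q) (bitorsor_sym P) R (fun X q p r => Cl X p q r).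
Proof.
move=> T; split=> /=.
- by move=> X Y q p r u; apply: (tensor_comp T).
- by move=> X q p r /(tensor_fiber T).
- by move=> X q p r r'; apply: (tensor_functional T).
- by move=> X q p e; apply: (tensor_total T).
- move=> X q p r k e c; apply: (tensor_invariant T) => //.
  by rewrite (tensor_fiber T c).
- move=> X q q' p p' r c c'; have [k [k1 [k2 k3]]] := tensor_orbit T c c'.
  by exists k; rewrite -(tensor_fiber T c).
- move=> X r; apply: locally_mono (tensor_surjective T r) => U v [p [q c]].
  by exists q, p.
Qed.

Section TensorLeft.
Variables (C : site) (hC : good_site C) (G K H : groupoid C).
Variables (P : bitorsor G K) (Q : bitorsor K H) (R : C).
Variable Cl : forall X : C, hom X (bt_ob P) -> hom X (bt_ob Q) -> hom X R -> Prop.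
Hypothesis T : is_tensor Cl.

(** The action of [K] preserves the anchor of [P] over [G], which therefore
    descends to classes. *)
Lemma tensor_anchor :
  exists a : hom R (gr_ob G), submersion a /\
    forall (X : C) (p : hom X (bt_ob P)) (q : hom X (bt_ob Q)) (r : hom X R),
      Cl p q r -> a ∘ r = lanc P ∘ p.
Proof.
have [||| a Ha] := locally_glue hC
  (Phi := fun U (v : hom U R) z => exists p q, Cl p q v /\ z = lanc P ∘ p).
- move=> U V v z u [p [q [c ->]]].
  by exists (p ∘ u), (q ∘ u); rewrite comp_assoc; split=> //; apply: (tensor_comp T).
- move=> U v z z' [p [q [c ->]]] [p' [q' [c' ->]]].
  have [k [k1 [<- _]]] := tensor_orbit T c c'.
  by rewrite (proj1 (ract_transitive P)).
- apply: locally_mono (tensor_surjective T (idm R)) => U v [p [q]].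
  by rewrite comp_idl => c; exists (lanc P ∘ p), p, q.
- have aP X (p : hom X (bt_ob P)) (q : hom X (bt_ob Q)) (r : hom X R) :
    Cl p q r -> a ∘ r = lanc P ∘ p.
  by move=> c; apply: Ha; exists p, q.
exists a; split=> //.
(* The composite with the projection [rho] from [P ×_K Q] is a submersion. *)
have [V] := proj1 (lanc_submersion Q) _ (ranc P).
have [rho c] := tensor_total T (pb_comm V).
apply: (GS5 hC (g := rho)); rewrite (aP _ _ _ _ c).
apply: submersion_comp (lanc_submersion P) _.
exact: submersion_pb1 (lanc_submersion Q).
Qed.

Variable a : hom R (gr_ob G).
Hypothesis aP : forall (X : C) (p : hom X (bt_ob P)) (q : hom X (bt_ob Q))
  (r : hom X R), Cl p q r -> a ∘ r = lanc P ∘ p.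

(** The product [g r] must be the class of [(g p, q)] when [r] is the class of
    [(p, q)]. This does not depend on the representative because the actions
    of [G] and [K] on [P] commute. *)
Lemma tensor_lact_exists (X : C) (g : hom X (gr_arr G)) (r : hom X R) :
  src G ∘ g = a ∘ r ->
  exists r' : hom X R,
    forall (U : C) (u : hom U X) (p : hom U (bt_ob P)) (q : hom U (bt_ob Q)),
      Cl p q (r ∘ u) -> Cl (act (lact_on P) (g ∘ u) p) q (r' ∘ u).
Proof.
move=> e.
have eu U (u : hom U X) (p : hom U (bt_ob P)) (q : hom U (bt_ob Q)) :
    Cl p q (r ∘ u) -> src G ∘ (g ∘ u) = lanc P ∘ p.
  by move=> c; rewrite -(aP c); apply: comp_eq.
have tot U (u : hom U X) (p : hom U (bt_ob P)) (q : hom U (bt_ob Q)) :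
    Cl p q (r ∘ u) -> exists z, Cl (act (lact_on P) (g ∘ u) p) q z.
  move=> c; apply: (tensor_total T).
  by rewrite (proj1 (lact_transitive P)) ?(eu _ _ _ _ c) // (tensor_fiber T c).
have [||| r' Hr'] := locally_glue hC (Phi := fun U (u : hom U X) z =>
  exists p q, Cl p q (r ∘ u) /\ Cl (act (lact_on P) (g ∘ u) p) q z).
- move=> U V u z v [p [q [c c']]].
  exists (p ∘ v), (q ∘ v); rewrite !comp_assoc.
  split; first exact: (tensor_comp T).
  by rewrite -act_comp ?(eu _ _ _ _ c) //; apply: (tensor_comp T).
- move=> U u z z' [p [q [c cz]]] [p' [q' [c' cz']]].
  have [k [k1 [kp kq]]] := tensor_orbit T c c'.
  apply: (tensor_functional T) cz'; rewrite -kp -kq.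
  rewrite acts_commute ?(eu _ _ _ _ c) //; apply: (tensor_invariant T) => //.
  by rewrite (proj1 (lact_transitive P)) ?(eu _ _ _ _ c).
- apply: locally_mono (tensor_surjective T r) => U u [p [q c]].
  by have [z cz] := tot _ _ _ _ c; exists z, p, q.
- exists r' => U u p q c; have [z cz] := tot _ _ _ _ c.
by rewrite (Hr' _ _ z) //; exists p, q.
Qed.

Let lop X (g : hom X (gr_arr G)) (r : hom X R) : hom X R :=
  match excluded_middle_informative (src G ∘ g = a ∘ r) with
  | left e =>
      proj1_sig (constructive_indefinite_description _ (tensor_lact_exists e))
  | right _ => r
  end.

Lemma lop_class X (g : hom X (gr_arr G)) (r : hom X R) :
  src G ∘ g = a ∘ r ->
  forall (U : C) (u : hom U X) (p : hom U (bt_ob P)) (q : hom U (bt_ob Q)),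
    Cl p q (r ∘ u) -> Cl (act (lact_on P) (g ∘ u) p) q (lop g r ∘ u).
Proof.
move=> e; rewrite /lop; case: excluded_middle_informative => // e'.
by case: constructive_indefinite_description.
Qed.

Lemma src_class X (g : hom X (gr_arr G)) (r : hom X R) :
  src G ∘ g = a ∘ r ->
  forall (U : C) (u : hom U X) (p : hom U (bt_ob P)) (q : hom U (bt_ob Q)),
    Cl p q (r ∘ u) -> src G ∘ (g ∘ u) = lanc P ∘ p.
Proof. by move=> e U u p q c; rewrite -(aP c); apply: comp_eq. Qed.

Lemma anchor_lop X (g : hom X (gr_arr G)) (r : hom X R) :
  src G ∘ g = a ∘ r -> a ∘ lop g r = tgt G ∘ g.
Proof.
move=> e; apply: (locally_eq hC).
apply: locally_mono (tensor_surjective T r) => U v [p [q c]].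
have c' := lop_class e c.
by rewrite -!comp_assoc (aP c') anchor_act ?(src_class e c).
Qed.

Definition tensor_lact : action a.
Proof.
refine (@Action _ _ _ _ lop _ anchor_lop _ _).
- move=> X Y g r u e; apply: (locally_eq hC).
  apply: locally_mono (tensor_surjective T (r ∘ u)) => U v [p [q c]].
  have e' : src G ∘ (g ∘ u) = a ∘ (r ∘ u) by apply: comp_eq.
  have c1 := lop_class e' c; rewrite -comp_assoc in c.
  have c2 := lop_class e c; rewrite comp_assoc in c2.
  by rewrite -comp_assoc; apply: (tensor_functional T) c1.
- move=> X r; apply: (locally_eq hC).
  apply: locally_mono (tensor_surjective T r) => U v [p [q c]].
  have e : src G ∘ (unit_ G ∘ (a ∘ r)) = a ∘ r by rewrite src_unit_el.
  have := lop_class e c.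
  rewrite -!comp_assoc (aP c) act_unit => c'.
  exact: (tensor_functional T) c.
- move=> X g h r egh eh; apply: (locally_eq hC).
  apply: locally_mono (tensor_surjective T r) => U v [p [q c]].
  have e1 : src G ∘ (g ⋅ h) = a ∘ r by rewrite src_gm.
  have e2 : src G ∘ g = a ∘ lop h r by rewrite anchor_lop.
  have ch := lop_class eh c; have cg := lop_class e2 ch; have c1 := lop_class e1 c.
  apply: (tensor_functional T) cg.
  rewrite -act_gm -?gm_comp //; first exact: comp_eq.
  exact: src_class c.
Defined.

Lemma tensor_lact_class X (g : hom X (gr_arr G)) (p : hom X (bt_ob P))
    (q : hom X (bt_ob Q)) (r : hom X R) :
  src G ∘ g = lanc P ∘ p ->
  Cl p q r -> Cl (act (lact_on P) g p) q (act tensor_lact g r).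
Proof.
move=> e c; have e' : src G ∘ g = a ∘ r by rewrite (aP c).
by have := @lop_class _ _ _ e' _ (idm X) p q; rewrite !comp_idr; apply.
Qed.

Variable b : hom R (gr_ob H).
Hypothesis bP : forall (X : C) (p : hom X (bt_ob P)) (q : hom X (bt_ob Q))
  (r : hom X R), Cl p q r -> b ∘ r = ranc Q ∘ q.

(** If [(g p, q)] and [(g' p, q)] have the same class, they differ by an
    element of [K] fixing [q], hence by a unit. *)
Lemma tensor_lact_free X (g g' : hom X (gr_arr G)) (r : hom X R) :
  src G ∘ g = a ∘ r -> src G ∘ g' = a ∘ r ->
  act tensor_lact g r = act tensor_lact g' r -> g = g'.
Proof.
move=> e e' E; apply: (locally_eq hC).
apply: locally_mono (tensor_surjective T r) => U v [p [q c]].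
have eg := src_class e c; have eg' := src_class e' c.
have c1 := tensor_lact_class eg c; have c2 := tensor_lact_class eg' c.
rewrite -!act_comp // E in c1 c2.
have [k [k1 [k2 k3]]] := tensor_orbit T c1 c2.
rewrite (proj1 (lact_transitive P)) // (tensor_fiber T c) in k1.
have ku : k = unit_ K ∘ (lanc Q ∘ q).
  apply: (simply_transitive_inj (lact_transitive Q) k1).
    exact: src_unit_el.
  by rewrite act_unit.
apply: (simply_transitive_inj (lact_transitive P) eg eg').
rewrite -k2 ku -(tensor_fiber T c).
by rewrite -(proj1 (lact_transitive P) _ _ _ eg) act_unit.
Qed.

(** Let [(p, q)] and [(p', q')] represent two elements over the same point of
    the base of [H]. Moving the first pair by [K], one may assume [q = q'], and
    then [p] and [p'] differ by a unique element of [G]. Such local solutions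
    glue by [tensor_lact_free]. *)
Lemma tensor_lact_transitive : simply_transitive tensor_lact b.
Proof.
split=> [X g r e | X r r' err].
  apply: (locally_eq hC).
  apply: locally_mono (tensor_surjective T r) => U v [p [q c]].
  have c' := tensor_lact_class (src_class e c) c.
  by rewrite -!comp_assoc act_comp // (bP c) (bP c').
have loc : locally (fun U (v : hom U X) => exists g : hom U (gr_arr G),
    src G ∘ g = a ∘ (r ∘ v) /\ act tensor_lact g (r ∘ v) = r' ∘ v).
  apply: locally_mono
    (locally_and (tensor_surjective T r) (tensor_surjective T r')).
  move=> U v [[p [q c]] [p' [q' c']]].
  have eq : ranc Q ∘ q = ranc Q ∘ q' by rewrite -(bP c) -(bP c'); apply: comp_eq.
  have [k [[k1 k2] _]] := proj2 (lact_transitive Q) _ _ _ eq.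
  have k3 : src K ∘ k = ranc P ∘ p by rewrite k1 (tensor_fiber T c).
  have ck := tensor_invariant T k3 c; rewrite k2 in ck.
  have ep : ranc P ∘ act (ract_on P) k p = ranc P ∘ p'.
    by rewrite (tensor_fiber T ck) (tensor_fiber T c').
  have [g [[g1 g2] _]] := proj2 (lact_transitive P) _ _ _ ep.
  exists g; split; first by rewrite (aP ck).
  apply: (tensor_functional T) c'; rewrite -g2; exact: tensor_lact_class.
have [|||g Hg] := locally_glue hC (Phi := fun U (v : hom U X) g =>
    src G ∘ g = a ∘ (r ∘ v) /\ act tensor_lact g (r ∘ v) = r' ∘ v) => //.
- move=> U V v g u [g1 g2]; rewrite (comp_assoc r) (comp_assoc r').
  by split; [apply: comp_eq | rewrite -act_comp // g2].
- by move=> U v g g' [g1 g2] [g3 g4]; apply: (tensor_lact_free g1); rewrite ?g4.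
- have eg : src G ∘ g = a ∘ r.
  apply: (locally_eq hC); apply: locally_mono loc => U v [h Hh].
  by rewrite -!comp_assoc (Hg _ _ _ Hh) (proj1 Hh).
exists g; split.
  split=> //; apply: (locally_eq hC); apply: locally_mono loc => U v [h Hh].
  by rewrite act_comp // (Hg _ _ _ Hh) (proj2 Hh).
move=> g' [g1 g2]; apply: (tensor_lact_free eg g1); rewrite g2.
apply: (locally_eq hC); apply: locally_mono loc => U v [h Hh].
by rewrite act_comp // (Hg _ _ _ Hh) (proj2 Hh).
Qed.

End TensorLeft.

Lemma bitorsor_of_tensor (C : site) (hC : good_site C) (G K H : groupoid C)
    (P : bitorsor G K) (Q : bitorsor K H) (R : C)
    (Cl : forall X : C, hom X (bt_ob P) -> hom X (bt_ob Q) -> hom X R -> Prop) :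
  is_tensor Cl -> inhabited (bitorsor G H).
Proof.
move=> T; have T' := is_tensor_sym T.
have [a [sa aP]] := tensor_anchor hC T.
have [b [sb bP]] := tensor_anchor hC T'.
have bP' X p q (r : hom X R) : Cl X p q r -> b ∘ r = ranc Q ∘ q by apply: bP.
have aP' X q p (r : hom X R) : Cl X p q r -> a ∘ r = ranc (bitorsor_sym P) ∘ p.
  exact: aP.
split; refine (@Bitorsor _ _ _ R a b (tensor_lact hC T aP)
  (tensor_lact hC T' bP) sa sb _ _ _).
- exact: (tensor_lact_transitive hC T aP bP').
- exact: (tensor_lact_transitive hC T' bP aP').
- move=> X g h r eg eh; apply: (locally_eq hC).
  apply: locally_mono (tensor_surjective T r) => U v [p [q c]].
  have egp := src_class aP eg c; have ehq := src_class bP eh c.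
  have cg := tensor_lact_class hC T aP egp c.
  have ch := tensor_lact_class hC T' bP ehq c.
  have cgh := tensor_lact_class hC T aP egp ch.
  have chg := tensor_lact_class hC T' bP ehq cg.
  have eg' : src G ∘ (g ∘ v) = a ∘ (r ∘ v) by apply: comp_eq.
  have eh' : src H ∘ (h ∘ v) = b ∘ (r ∘ v) by apply: comp_eq.
  have bg := proj1 (tensor_lact_transitive hC T aP bP') _ _ _ eg.
  have ah := proj1 (tensor_lact_transitive hC T' bP aP') _ _ _ eh.
  rewrite !act_comp // ?ah ?bg //.
  exact: (tensor_functional T) cgh chg.
Qed.

(** * The quotient by descent *)

Section Tensor.
Variables (C : site) (hC : good_site C) (G K H : groupoid C).
Variables (P : bitorsor G K) (Q : bitorsor K H).

(** A chosen lift [p] to [P] of a morphism [s] in [S], and the pullback of [Q]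
    along the image of [p] in the base of [K]. *)
Let S := lifting_sieve (lanc P).

Let lift U (s : hom U (gr_ob G)) (Ss : S U s) : hom U (bt_ob P) :=
  proj1_sig (constructive_indefinite_description _ Ss).

Lemma lift_eq U (s : hom U (gr_ob G)) (Ss : S U s) : lanc P ∘ lift Ss = s.
Proof. by rewrite /lift; case: constructive_indefinite_description. Qed.

Let W U (s : hom U (gr_ob G)) (Ss : S U s) : pullback (ranc P ∘ lift Ss) (lanc Q) :=
  pick_pullback (proj1 (lanc_submersion Q) _ (ranc P ∘ lift Ss)).

Lemma lift_change U V (s : hom U (gr_ob G)) (r : hom V (gr_ob G)) (Ss : S U s)
    (Sr : S V r) (g : hom U V) :
  r ∘ g = s -> lanc P ∘ lift Ss = lanc P ∘ (lift Sr ∘ g).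
Proof. by rewrite comp_assoc !lift_eq. Qed.

Section Transition.
Variables (U V : C) (s : hom U (gr_ob G)) (r : hom V (gr_ob G)).
Variables (Ss : S U s) (Sr : S V r) (g : hom U V) (e : r ∘ g = s).

(** The element of [K] that carries the lift of [s] to the restricted lift of
    [r]; the transition acts by it on [Q]. *)
Let k := transporter (ract_transitive P) (lift_change Ss Sr e).

Lemma src_k X (x : hom X U) : src K ∘ (k ∘ x) = ranc P ∘ lift Ss ∘ x.
Proof. by rewrite comp_assoc src_transporter. Qed.

Lemma tgt_k X (x : hom X U) : tgt K ∘ (k ∘ x) = ranc P ∘ lift Sr ∘ (g ∘ x).
Proof. by rewrite comp_assoc tgt_transporter -!comp_assoc. Qed.

Lemma transition_exists : exists f : hom (W Ss) (W Sr),
  pb1 (W Sr) ∘ f = g ∘ pb1 (W Ss) /\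
  pb2 (W Sr) ∘ f = act (lact_on Q) (k ∘ pb1 (W Ss)) (pb2 (W Ss)).
Proof.
have e1 : src K ∘ (k ∘ pb1 (W Ss)) = lanc Q ∘ pb2 (W Ss).
  by rewrite src_k pb_comm.
have e2 : ranc P ∘ lift Sr ∘ (g ∘ pb1 (W Ss)) =
    lanc Q ∘ act (lact_on Q) (k ∘ pb1 (W Ss)) (pb2 (W Ss)).
  by rewrite anchor_act // tgt_k.
by exists (pb_pair (W Sr) e2); rewrite pb_pair1 pb_pair2.
Qed.

Definition transition : hom (W Ss) (W Sr) :=
  proj1_sig (constructive_indefinite_description _ transition_exists).

Lemma transition_eq X (x : hom X (W Ss)) :
  pb1 (W Sr) ∘ (transition ∘ x) = g ∘ (pb1 (W Ss) ∘ x) /\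
  pb2 (W Sr) ∘ (transition ∘ x) =
    act (lact_on Q) (k ∘ (pb1 (W Ss) ∘ x)) (pb2 (W Ss) ∘ x).
Proof.
rewrite /transition; case: constructive_indefinite_description => f /= [f1 f2].
rewrite (comp_assoc (pb1 _)) (comp_assoc (pb2 _)) f1 f2 -comp_assoc; split=> //.
by rewrite act_comp -?comp_assoc // src_k pb_comm.
Qed.

Lemma transition_pullback :
  is_pullback g (pb1 (W Sr)) (pb1 (W Ss)) transition.
Proof.
apply: pullback_of_elements.
- by have [+ _] := transition_eq (idm _); rewrite !comp_idr => ->.
- move=> X x y exy.
  have e1 : src K ∘ (inv K ∘ (k ∘ x)) = lanc Q ∘ (pb2 (W Sr) ∘ y).
    by rewrite src_inv_el tgt_k exy; apply: comp_eq; apply: pb_comm.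
  have e2 : ranc P ∘ lift Ss ∘ x =
      lanc Q ∘ act (lact_on Q) (inv K ∘ (k ∘ x)) (pb2 (W Sr) ∘ y).
    by rewrite anchor_act // tgt_inv_el src_k.
  exists (pb_pair (W Ss) e2); rewrite pb_pair1; split=> //.
  have [t1 t2] := transition_eq (pb_pair (W Ss) e2).
  apply: pb_ext; rewrite ?t1 ?t2 pb_pair1 // pb_pair2 actVK //.
  by rewrite -src_inv_el.
- move=> X u v e1 e2; apply: pb_ext => //.
  have [_ t2] := transition_eq u; have [_ t2'] := transition_eq v.
  have eu : src K ∘ (k ∘ (pb1 (W Ss) ∘ u)) = lanc Q ∘ (pb2 (W Ss) ∘ u).
    by rewrite src_k; apply: comp_eq; apply: pb_comm.
  have ev : src K ∘ (k ∘ (pb1 (W Ss) ∘ v)) = lanc Q ∘ (pb2 (W Ss) ∘ v).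
    by rewrite src_k; apply: comp_eq; apply: pb_comm.
  by rewrite -(actKV (lact_on Q) eu) -(actKV (lact_on Q) ev) -t2 -t2' e2 e1.
Qed.

End Transition.

Arguments transition {U V s r} Ss Sr {g} e.
Arguments transition_eq {U V s r} Ss Sr {g} e {X} x.
Arguments transition_pullback {U V s r} Ss Sr {g} e.

Lemma transition_id U (s : hom U (gr_ob G)) (Ss : S U s) (e : s ∘ idm U = s) :
  transition Ss Ss e = idm (W Ss).
Proof.
have [t1 t2] := transition_eq Ss Ss e (idm (W Ss)).
rewrite comp_idr in t1 t2.
have ku : transporter (ract_transitive P) (lift_change Ss Ss e) =
    unit_ K ∘ (ranc P ∘ lift Ss).
  apply: (simply_transitive_inj (ract_transitive P) (p := lift Ss)).
    exact: src_transporter.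
    exact: src_unit_el.
  by rewrite act_transporter act_unit comp_idr.
apply: pb_ext; rewrite ?t1 ?t2 ?comp_idl // ku !comp_idr.
by rewrite -comp_assoc pb_comm act_unit.
Qed.

(** The elements of [K] comparing three lifts multiply, as both the product
    and the third one carry the first lift to the last. *)
Lemma transition_comp (U V X : C) (s : hom U (gr_ob G)) (r : hom V (gr_ob G))
    (q : hom X (gr_ob G)) (Ss : S U s) (Sr : S V r) (Sq : S X q) (g : hom V X)
    (h : hom U V) (eg : q ∘ g = r) (eh : r ∘ h = s) (egh : q ∘ (g ∘ h) = s) :
  transition Sr Sq eg ∘ transition Ss Sr eh = transition Ss Sq egh.
Proof.
have [t1 t2] := transition_eq Ss Sr eh (idm (W Ss)).
have [t3 t4] := transition_eq Ss Sq egh (idm (W Ss)).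
have [t5 t6] := transition_eq Sr Sq eg (transition Ss Sr eh).
rewrite !comp_idr in t1 t2 t3 t4; rewrite t1 t2 in t5 t6.
set kg := transporter _ _ in t6; set kh := transporter _ _ in t6.
set kgh := transporter _ _ in t4.
have e1 : src K ∘ (kg ∘ h) = tgt K ∘ kh.
  by rewrite comp_assoc src_transporter tgt_transporter comp_assoc.
have ek : kgh = (kg ∘ h) ⋅ kh.
  apply: (simply_transitive_inj (ract_transitive P) (p := lift Ss)).
    exact: src_transporter.
    by rewrite src_gm // src_transporter.
  rewrite act_transporter act_gm ?src_transporter // act_transporter -act_comp.
    by rewrite src_transporter.
  by rewrite act_transporter comp_assoc.
apply: pb_ext; first by rewrite t3 t5 comp_assoc.
rewrite t4 t6 ek gm_comp // act_gm.
- exact: comp_eq.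
- by rewrite comp_assoc src_transporter pb_comm.
- by rewrite -(comp_assoc kg).
Qed.

Definition tensor_descent : descent_datum (Sub C) S.
Proof.
refine (@DescentDatum _ (Sub C) _ S
  (fun U s Ss => SubOb (submersion_pb1 (W Ss) (lanc_submersion Q)))
  (fun U V s r Ss Sr g e =>
     @SubArr _ _ _ (SubOb (submersion_pb1 (W Ss) (lanc_submersion Q)))
       (SubOb (submersion_pb1 (W Sr) (lanc_submersion Q)))
       _ _ (transition_pullback Ss Sr e)) _ _ _).
- by [].
- by move=> U s Ss e; apply: sub_arr_eq => //; apply: transition_id.
- move=> U V X s r q Ss Sr Sq g h eg eh egh; apply: sub_arr_eq => //.
  exact: transition_comp.
Defined.

(** The object [R] glued from the descent datum comes with maps [al] to it from
    the local models [W]. The class of [(p, q)] is the image under [al] of the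
    point of [W] obtained by carrying [p] to the chosen lift by [k] and moving
    [q] along. Since the square of [al] is a pullback, a class determines
    this point, hence its representatives up to [K]. *)
Lemma tensor_exists : exists R Cl, @is_tensor C G K H P Q R Cl.
Proof.
have cS : covers S := lifting_sieve_covers (lanc_submersion P).
have [_ /(_ _ _ cS) [_ /(_ tensor_descent)]] := GS4 hC.
move=> [[R a sa] [alpha [base compat]]].
pose al U (s : hom U (gr_ob G)) (Ss : S U s) : hom (W Ss) R := sub_top (alpha U s Ss).
have pba U (s : hom U (gr_ob G)) (Ss : S U s) : is_pullback s a (pb1 (W Ss)) (al U s Ss).
  have := sub_pullback (alpha U s Ss).
  by rewrite (base U s Ss : sub_base _ = s).
have alc U V s r Ss Sr g (e : r ∘ g = s) :
    al V r Sr ∘ transition Ss Sr e = al U s Ss.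
  exact: (f_equal (@sub_top _ _ _ _ _) (compat U V s r Ss Sr g e)).
pose Cl X (p : hom X (bt_ob P)) (q : hom X (bt_ob Q)) (r : hom X R) :=
  exists (s : hom X (gr_ob G)) (Ss : S X s) (w : hom X (W Ss)) (k : hom X (gr_arr K)),
    ranc P ∘ p = lanc Q ∘ q /\ src K ∘ k = ranc P ∘ p /\
    act (ract_on P) k p = lift Ss /\ pb1 (W Ss) ∘ w = idm X /\
    pb2 (W Ss) ∘ w = act (lact_on Q) k q /\ al X s Ss ∘ w = r.
have base_eq X (p : hom X (bt_ob P)) s (Ss : S X s) (k : hom X (gr_arr K)) :
    src K ∘ k = ranc P ∘ p -> act (ract_on P) k p = lift Ss -> s = lanc P ∘ p.
  by move=> e1 e2; rewrite -(lift_eq Ss) -e2 (proj1 (ract_transitive P)).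
exists R, Cl; split.
- move=> X Y p q r u [s [Ss [w [k [e [e1 [e2 [e3 [e4 e5]]]]]]]]].
  (* The lift chosen for [s ∘ u] need not be the restriction of the one chosen
     for [s]; [kt] carries the former to the latter. *)
  pose Su := sieve_closed u Ss.
  pose kt := transporter (ract_transitive P) (lift_change Su Ss eq_refl).
  have ew : u ∘ idm Y = pb1 (W Ss) ∘ (w ∘ u).
    by rewrite comp_assoc e3 comp_idl comp_idr.
  have [w' [[w1 w2] _]] := proj2 (transition_pullback Su Ss eq_refl) _ _ _ ew.
  have [_ t] := transition_eq Su Ss eq_refl w'.
  rewrite w1 w2 comp_idr -/kt in t.
  have ekt : src K ∘ kt = lanc Q ∘ (pb2 (W Su) ∘ w').
    by rewrite src_transporter comp_assoc -pb_comm -comp_assoc w1 comp_idr.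
  have eku : src K ∘ (k ∘ u) = ranc P ∘ (p ∘ u) by exact: comp_eq.
  have ekuq : src K ∘ (k ∘ u) = lanc Q ∘ (q ∘ u).
    by apply: comp_eq; rewrite e1.
  have ek : src K ∘ (inv K ∘ kt) = tgt K ∘ (k ∘ u).
    rewrite src_inv_el tgt_transporter -(anchor_act (ract_on P) eku).
    by rewrite -act_comp // e2.
  exists (s ∘ u), Su, w', ((inv K ∘ kt) ⋅ (k ∘ u)).
  rewrite src_gm // !act_gm // -!act_comp ?e1 // e2 -e4.
  split; first exact: comp_eq.
  split=> //; split.
    by rewrite -(act_transporter (ract_transitive P) (lift_change Su Ss eq_refl))
      actKV ?src_transporter.
  split=> //; split.
    by rewrite -comp_assoc t actKV.
  by rewrite -(alc _ _ _ _ Su Ss u eq_refl) -comp_assoc w2 comp_assoc e5.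
- by move=> X p q r [s [Ss [w [k [e _]]]]].
- move=> X p q r r' [s [Ss [w [k [_ [e1 [e2 [e3 [e4 <-]]]]]]]]].
  move=> [s' [Ss' [w' [k' [_ [e1' [e2' [e3' [e4' <-]]]]]]]]].
  have es : s' = s by rewrite (base_eq _ _ _ _ _ e1 e2) (base_eq _ _ _ _ _ e1' e2').
  subst s'; have eS := proof_irrelevance _ Ss' Ss; subst Ss'.
  have ek : k = k'.
    by apply: (simply_transitive_inj (ract_transitive P) (p := p)); rewrite ?e2.
  by congr (_ ∘ _); apply: pb_ext; rewrite ?e3 ?e4 ?e3' ?e4' ?ek.
- move=> X p q e.
  have Ss : S X (lanc P ∘ p) by exists p.
  have el : lanc P ∘ p = lanc P ∘ lift Ss by rewrite lift_eq.
  pose k := transporter (ract_transitive P) el.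
  have k1 : src K ∘ k = ranc P ∘ p by exact: src_transporter.
  have ew : ranc P ∘ lift Ss ∘ idm X = lanc Q ∘ act (lact_on Q) k q.
    by rewrite anchor_act ?k1 // tgt_transporter comp_idr.
  exists (al X _ Ss ∘ pb_pair (W Ss) ew), (lanc P ∘ p), Ss, (pb_pair (W Ss) ew), k.
  by rewrite act_transporter pb_pair1 pb_pair2.
- move=> X p q r l el [s [Ss [w [k [e [e1 [e2 [e3 [e4 e5]]]]]]]]].
  have elq : src K ∘ l = lanc Q ∘ q by rewrite el.
  have ekl : src K ∘ k = tgt K ∘ (inv K ∘ l) by rewrite tgt_inv_el e1.
  exists s, Ss, w, (k ⋅ (inv K ∘ l)).
  have ilp : src K ∘ (inv K ∘ l) = ranc P ∘ act (ract_on P) l p.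
    by rewrite anchor_act // src_inv_el.
  have ilq : src K ∘ (inv K ∘ l) = lanc Q ∘ act (lact_on Q) l q.
    by rewrite anchor_act // src_inv_el.
  by rewrite !act_gm // !actKV // src_gm // -ilp -ilq.
- move=> X p p' q q' r [s [Ss [w [k [e [e1 [e2 [e3 [e4 e5]]]]]]]]].
  move=> [s' [Ss' [w' [k' [e' [e1' [e2' [e3' [e4' e5']]]]]]]]].
  have es : s' = s.
    rewrite -(comp_idr s') -e3' comp_assoc (proj1 (pba _ s' Ss')) -comp_assoc e5'.
    by rewrite -e5 comp_assoc -(proj1 (pba _ s Ss)) -comp_assoc e3 comp_idr.
  subst s'; have eS := proof_irrelevance _ Ss' Ss; subst Ss'.
  have ew : w = w'.
    by apply: (pb_ext (W := Pullback (pba _ s Ss))); rewrite /= ?e3 ?e5.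
  have ek : src K ∘ k' = lanc Q ∘ q' by rewrite e1'.
  have ekk : src K ∘ (inv K ∘ k') = tgt K ∘ k.
    rewrite src_inv_el -(anchor_act (ract_on P) e1) e2 -e2' anchor_act //.
  exists ((inv K ∘ k') ⋅ k); rewrite src_gm // !act_gm // -?e //.
  rewrite e2 -e2' actKV //.
  by rewrite -e4 ew e4' actKV.
- move=> X r.
  apply: locally_mono (submersion_locally (a ∘ r) (lanc_submersion P)) => U v Ss.
  have [w [[w1 w2] _]] := proj2 (pba U _ Ss) U (idm U) (r ∘ v)
    (eq_trans (comp_idr _) (eq_sym (comp_assoc _ _ _))).
  exists (lift Ss), (pb2 (W Ss) ∘ w), _, Ss, w, (unit_ K ∘ (ranc P ∘ lift Ss)).
  have e : ranc P ∘ lift Ss = lanc Q ∘ (pb2 (W Ss) ∘ w).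
    by rewrite comp_assoc -pb_comm -(comp_assoc (_ ∘ lift Ss)) w1 comp_idr.
  have eu := act_unit (lact_on Q) (pb2 (W Ss) ∘ w); rewrite -e in eu.
  by rewrite src_unit_el act_unit eu.
Qed.

End Tensor.

Lemma bitorsor_comp (C : site) (hC : good_site C) (G K H : groupoid C)
    (P : bitorsor G K) (Q : bitorsor K H) : inhabited (bitorsor G H).
Proof. by have [R [Cl /(bitorsor_of_tensor hC)]] := tensor_exists hC P Q. Qed.

(** * Morita equivalence and spans of weak equivalences *)

Theorem theorem2p2p2 (C : site) (hC : good_site C) (G H : groupoid C) :
  morita_equivalent G H <->
  exists (K : groupoid C) (F1 : groupoid_hom K H) (F2 : groupoid_hom K G),
    weak_equivalence F1 /\ weak_equivalence F2.
Proof.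
rewrite morita_equivalent_bitorsor; split=> [[P] | [K [F1 [F2 [[]]]]]].
  exact: weak_equivalences_of_bitorsor.
move=> [E1 s1] ff1 [[E2 s2] ff2].
have [Q] := bitorsor_of_weak_equivalence s1 ff1.
have [P] := bitorsor_of_weak_equivalence s2 ff2.
exact: (bitorsor_comp hC P (bitorsor_sym Q)).
Qed.
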